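(* Let $z_1,z_2,z_3,z_4$ be indeterminates. For every integer $n\ge 3$, the alternative quadruply-refined ASM generating function at $x=y=1$ satisfies $$\begin{aligned} &(z_4z_1-z_4+1)(z_1z_2-z_1+1)(z_2z_3-z_2+1)(z_3z_4-z_3+1)\,\widetilde{Z}^{\mathrm{quad}}_n(1,1;z_1,z_2,z_3,z_4)=\\ &\frac{z_1z_2z_3z_4}{\mathcal{A}_{n-2}\,(z_1-z_3)(z_2-z_4)}\times\\ &\quad\Bigl((z_1z_2-z_1+1)(z_1z_2-z_2+1)(z_3z_4-z_3+1)(z_3z_4-z_4+1)\,Z^{\mathrm{opp}}_{n-1}(1,1;z_4,z_1)\,Z^{\mathrm{opp}}_{n-1}(1,1;z_2,z_3)\\ &\quad\;-(z_4z_1-z_4+1)(z_4z_1-z_1+1)(z_2z_3-z_2+1)(z_2z_3-z_3+1)\,Z^{\mathrm{opp}}_{n-1}(1,1;z_1,z_2)\,Z^{\mathrm{opp}}_{n-1}(1,1;z_3,z_4)\Bigr)\\ &+(z_2-1)(z_3-1)(z_1z_2-z_1+1)(z_3z_4-z_3+1)\,z_4z_1z_2^{n-1}\,Z^{\mathrm{opp}}_{n-1}(1,1;z_4,z_1)\\ &+(z_3-1)(z_4-1)(z_2z_3-z_2+1)(z_4z_1-z_4+1)\,z_1z_2z_3^{n-1}\,Z^{\mathrm{opp}}_{n-1}(1,1;z_1,z_2)\\ &+(z_4-1)(z_1-1)(z_3z_4-z_3+1)(z_1z_2-z_1+1)\,z_2z_3z_4^{n-1}\,Z^{\mathrm{opp}}_{n-1}(1,1;z_2,z_3)\\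 &+(z_1-1)(z_2-1)(z_4z_1-z_4+1)(z_2z_3-z_2+1)\,z_3z_4z_1^{n-1}\,Z^{\mathrm{opp}}_{n-1}(1,1;z_3,z_4)\\ &+(z_1-1)(z_2-1)(z_3-1)(z_4-1)\Bigl((z_1z_2-z_1+1)(z_3z_4-z_3+1)(z_2z_4)^{n-1}\\ &\qquad\qquad+(z_2z_3-z_2+1)(z_4z_1-z_4+1)(z_1z_3)^{n-1}\Bigr)\mathcal{A}_{n-2}. \end{aligned}$$
   Context: An alternating sign matrix (ASM) is a square matrix with entries in $\{0,1,-1\}$ such that along each row and each column the nonzero entries alternate in sign and sum to $1$. $\mathrm{ASM}(n)$ is the set of $n\times n$ ASMs, and $\mathcal{A}_n=|\mathrm{ASM}(n)|$. The first and last rows and columns of an ASM each contain exactly one $1$, all other entries there being $0$. For $A\in\mathrm{ASM}(n)$ define: $\rho_{\mathrm T}(A)=$ number of $0$'s to the left of the $1$ in the top row; $\rho_{\mathrm R}(A)=$ number of $0$'s below the $1$ in the right-most column; $\rho_{\mathrm B}(A)=$ number of $0$'s to the right of the $1$ in the bottom row; $\rho_{\mathrm L}(A)=$ number of $0$'s above the $1$ in the left-most column. Generating functions with both bulk parameters equal to $1$ (for $n\ge1$): $\widetilde{Z}^{\mathrm{quad}}_n(1,1;z_1,z_2,z_3,z_4)=\sum_{A\in\mathrm{ASM}(n)}z_1^{\rho_{\mathrm T}(A)}z_2^{n-1-\rho_{\mathrm R}(A)}z_3^{\rho_{\mathrm B}(A)}z_4^{n-1-\rho_{\mathrm L}(A)}$;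 $Z^{\mathrm{opp}}_n(1,1;z_1,z_2)=\sum_{A\in\mathrm{ASM}(n)}z_1^{\rho_{\mathrm T}(A)}z_2^{\rho_{\mathrm B}(A)}$. *)

(* Defs.v *)
From mathcomp Require Import all_boot all_order all_algebra.
From mathcomp Require Export fraction.
From mathcomp.multinomials Require Export mpoly.

Set Implicit Arguments.
Unset Strict Implicit.
Unset Printing Implicit Defensive.

Import GRing.Theory.
Local Open Scope ring_scope.

(* The entries range over a finite type, so that the ASMs of a given size form
   a finite set; [val] maps an entry to the integer it denotes. *)
Notation asm_entry := (seq_sub [:: 0; 1; -1 : int]).

Definition asm_line (s : seq int) : bool :=
  sorted (fun x y => y == - x) [seq x <- s | x != 0] && (\sum_(x <- s) x == 1).

Section Matrices.
Variable n : nat.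
Implicit Type A : 'M[asm_entry]_n.

Definition asm_rows A : seq (seq int) :=
  [seq [seq val (A i j) | j <- enum 'I_n] | i <- enum 'I_n].

Definition asm_cols A : seq (seq int) := asm_rows A^T.

Definition is_asm A : bool :=
  all asm_line (asm_rows A) && all asm_line (asm_cols A).

(* Number of 0's preceding the first 1 of a sequence; the four boundary
   statistics below read a boundary line in the appropriate direction. *)
Definition zeros_before_one (s : seq int) : nat :=
  count_mem 0 (take (index 1 s) s).

Definition rhoT A : nat := zeros_before_one (head [::] (asm_rows A)).
Definition rhoR A : nat := zeros_before_one (rev (last [::] (asm_cols A))).
Definition rhoB A : nat := zeros_before_one (rev (last [::] (asm_rows A))).
Definition rhoL A : nat := zeros_before_one (head [::] (asm_cols A)).

End Matrices.

Definition ASM (n : nat) : {set 'M[asm_entry]_n} := [set A | is_asm A].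

Definition asm_number (n : nat) : nat := #|ASM n|.

Section GeneratingFunctions.
Variable R : comNzRingType.

Definition Zquad_alt (n : nat) (z1 z2 z3 z4 : R) : R :=
  \sum_(A in ASM n)
    z1 ^+ rhoT A * z2 ^+ (n - 1 - rhoR A) * z3 ^+ rhoB A
      * z4 ^+ (n - 1 - rhoL A).

Definition Zopp (n : nat) (z1 z2 : R) : R :=
  \sum_(A in ASM n) z1 ^+ rhoT A * z2 ^+ rhoB A.

End GeneratingFunctions.

Definition ratfun4 : fieldType := {fraction {mpoly int[4]}}.

(* The variables of [{mpoly int[4]}] are numbered from 0. *)
Definition indet (k : nat) : ratfun4 := tofrac ('X_(inord k) : {mpoly int[4]}).

(* Main.v *)
(* The supports of the n x n ASMs are the configurations of the six-vertex model
   with domain wall boundary. Give a zero the weight alpha u + beta v or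
   beta u + alpha v, and the entries 1 and -1 the weights v and u, where u and v
   are the spectral parameters of the row and of the column, alpha + beta = 1
   and alpha beta = 1/3; the partition function at u = v = 1 is the number of
   ASMs. By the Yang-Baxter equation and interpolation in one parameter, it is
   given by the determinant of the matrix with entries 1 / (u^2 + u v + v^2).
   This determinant is a quotient of a 2n x 2n determinant that treats the u's
   and the v's alike, whence a symmetry in all 2n parameters, and condensation
   (Desnanot-Jacobi) gives a bilinear identity between the sizes n, n-1, n-2.

   Now let all the parameters be 1 but those of the four extreme lines. On such
   a line the two weights of a zero have ratio z, so the partition function is
   the quadruply refined generating function up to a factor and to a correction
   at the corners. A 1 at a corner removes a row and a column, which yields the
   remaining terms; the symmetry turns the refinement with respect to adjacent
   boundary lines into the one with respect to opposite lines. *)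
Require Import Defs.
From mathcomp Require Import all_boot all_order all_algebra.
From mathcomp Require Import perm algC ring zify.

Set Implicit Arguments.
Unset Strict Implicit.
Unset Printing Implicit Defensive.

Import Order.TTheory GRing.Theory Num.Theory.
Local Open Scope ring_scope.

(** * Supports of alternating sign matrices *)

(** The weights need a [q] with [q ^+ 2 = q - 1], a primitive sixth root of unity. Then the
    denominators [s3 u v] of the determinant are [(u ^+ 3 - v ^+ 3) / (u - v)], and it is the
    passage to cubes that puts rows and columns on the same footing. The theorem, however, lives
    over the integers, where no such [q] exists. It is therefore restated as the vanishing of
    [defect], built from ring operations only, which is proved over the algebraic numbers and pulled
    back along injective morphisms. The determinant formula degenerates exactly where it is wanted,
    at parameters that are mostly equal to 1. Symmetry and condensation are first proved for
    parameters with distinct cubes, over any field of characteristic 0 containing [q], and reach the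
    other points by a perturbation in a field of fractions. Supports replace signed matrices because
    signs and validity become parities: two adjacent columns can be modified by adding a common
    Boolean vector, which is what the exchange of their parameters requires. *)

Section Parity.
Variable n : nat.
Implicit Types f g : 'I_n -> bool.

(** The partial sums of a line of an ASM are 0 or 1, so their parities, which depend on the support
    only, are the partial sums themselves. *)
Definition parity f : bool := \big[addb/false]_(k < n) f k.
Definition parity_before f (j : 'I_n) : bool := \big[addb/false]_(k < n | (k < j)%N) f k.

Lemma eq_parity f g : f =1 g -> parity f = parity g.
Proof. by move=> fg; apply: eq_bigr => k _. Qed.

Lemma eq_parity_before f g j : f =1 g -> parity_before f j = parity_before g j.
Proof. by move=> fg; apply: eq_bigr => k _. Qed.

Lemma parityD f g : parity (fun k => f k (+) g k) = parity f (+) parity g.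
Proof. exact: big_split. Qed.

Lemma parity_beforeD f g j : parity_before (fun k => f k (+) g k) j = parity_before f j (+) parity_before g j.
Proof. exact: big_split. Qed.

Lemma parity_before_suffix f (j : 'I_n) :
  \big[addb/false]_(k < n | (j < k)%N) f k = parity f (+) parity_before f j (+) f j.
Proof.
rewrite [parity f](bigID (fun k : 'I_n => (k <= j)%N)) /= [in RHS](bigD1 j) //=.
set s1 := (X in f j (+) X (+) _); set s2 := (X in _ (+) X (+) parity_before f j).
have -> : s1 = parity_before f j by apply: eq_bigl => k; rewrite ltn_neqAle andbC.
have <- : \big[addb/false]_(k < n | (j < k)%N) f k = s2.
  by apply: eq_bigl => k; rewrite -ltnNge.
by case: (f j); case: (parity_before f j); case: (\big[_/_]_(k < n | _) _).
Qed.

Lemma parity_before_next f (i j : 'I_n) : j = i.+1 :> nat -> parity_before f j = parity_before f i (+) f i.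
Proof.
move=> ij; rewrite /parity_before (bigD1 i) /= ?ij // addbC.
congr (_ (+) _); apply: eq_bigl => k.
by rewrite ltnS ltn_neqAle andbC.
Qed.

(** After the first nonzero entry the prefix parity is odd and stays odd, since a further nonzero
    entry would need an even prefix. The hypothesis holds on the top row, above which there is
    nothing. *)
Lemma line_unique f :
  parity f -> (forall j, f j -> ~~ parity_before f j) -> exists p, f =1 pred1 p.
Proof.
move=> tf nf.
have mono m : (m <= n)%N -> forall i : 'I_n, (i < m)%N -> f i ->
    \big[addb/false]_(k < n | (k < m)%N) f k.
  elim: m => // m IH lt_mn i; pose j := Ordinal lt_mn.
  have -> : \big[addb/false]_(k < n | (k < m.+1)%N) f k = parity_before f j (+) f j.
    rewrite (bigD1 j) //= addbC; congr (_ (+) _); apply: eq_bigl => k.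
    by rewrite ltnS ltn_neqAle andbC.
  have := @nf j; case fj: (f j); first by move=> /(_ isT) /negbTE->.
  move=> _; rewrite ltnS leq_eqVlt => /orP[/eqP im|lt_im] fi.
    have ij : i = j by apply: val_inj.
    by move: fj; rewrite -ij fi.
  by rewrite addbF; apply: IH fi => //; apply: ltnW.
have [p fp] : exists p, f p.
  apply/existsP; apply: contraLR tf; rewrite negb_exists => /forallP nof.
  by rewrite /parity big1 // => k _; apply/negbTE/nof.
exists p => j /=; apply/idP/eqP => [fj|->//].
apply: val_inj; case: (ltngtP j p) => // lt.
  by have := nf _ fp; rewrite /parity_before (mono p _ j) // ltnW.
by have := nf _ fj; rewrite /parity_before (mono j _ p) // ltnW.
Qed.

Lemma parity_before_pred1 p j : parity_before (pred1 p) j = (p < j)%N.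
Proof.
rewrite /parity_before; case: ltnP => pj.
  rewrite (bigD1 p) //= eqxx big1 // => k /andP[_ kp].
  by rewrite (negbTE kp).
by rewrite big1 // => k kj; apply/negbTE; apply: contraTneq pj => <-;
  rewrite -ltnNge.
Qed.

End Parity.

Lemma parity_recl n (f : 'I_n.+1 -> bool) :
  parity f = f ord0 (+) parity (fun i => f (lift ord0 i)).
Proof. exact: big_ord_recl. Qed.

Lemma parity_before0 n (f : 'I_n.+1 -> bool) : parity_before f ord0 = false.
Proof. by rewrite /parity_before big_pred0. Qed.

Lemma parity_before_recl n (f : 'I_n.+1 -> bool) i :
  parity_before f (lift ord0 i) = f ord0 (+) parity_before (fun i => f (lift ord0 i)) i.
Proof. by rewrite /parity_before big_mkcond big_ord_recl /= -big_mkcond. Qed.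

Lemma parity_before_max n (f : 'I_n.+1 -> bool) : parity_before f ord_max = parity f (+) f ord_max.
Proof.
have := parity_before_suffix f ord_max; rewrite big_pred0; last first.
  by move=> k; apply/negbTE; rewrite -leqNgt -ltnS.
by case: (parity f); case: (parity_before f _); case: (f _).
Qed.

Section Valid.
Variable n : nat.
Implicit Type X : 'M[bool]_n.

Definition lpar X i j := parity_before (X i) j.
Definition tpar X i j := parity_before (X^~ j) i.

(* The supports of the ASMs of size n: the entry at a position (i, j) of the
   support is -1 raised to lpar X i j, which has to equal tpar X i j. *)
Definition valid X :=
  [&& [forall i, parity (X i)], [forall j, parity (X^~ j)] &
      [forall i, forall j, X i j ==> (lpar X i j == tpar X i j)]].

Lemma validP X :
  reflect [/\ forall i, parity (X i), forall j, parity (X^~ j) &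
              forall i j, X i j -> lpar X i j = tpar X i j] (valid X).
Proof.
apply: (iffP and3P) => [[/forallP r /forallP c /forallP e]|[r c e]]; split=> //.
- by move=> i j x; apply/eqP; move/forallP/(_ j)/implyP: (e i); apply.
- exact/forallP.
- exact/forallP.
- by apply/forallP => i; apply/forallP => j; apply/implyP => /e /eqP.
Qed.

Lemma valid_tr X : valid X^T = valid X.
Proof.
have mk Y : valid Y -> valid Y^T.
  case/validP=> r c e; apply/validP; split.
  - by move=> i; rewrite (@eq_parity _ _ (Y^~ i)) // => k; rewrite mxE.
  - by move=> i; rewrite (@eq_parity _ _ (Y i)) // => k; rewrite mxE.
  move=> i j; rewrite mxE => /e eq; rewrite /lpar /tpar.
  transitivity (tpar Y j i); first by apply: eq_parity_before => k; rewrite mxE.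
  by rewrite -eq; apply: eq_parity_before => k; rewrite mxE.
by apply/idP/idP => /mk //; rewrite trmxK.
Qed.

(** Clockwise quarter turn. It permutes the four sides cyclically, so that a fact about one side or
    corner yields the other three. *)
Definition rotm X : 'M[bool]_n := \matrix_(i, j) X (rev_ord j) i.

Lemma rotm4 : cancel rotm (rotm \o rotm \o rotm).
Proof. by move=> X; apply/matrixP => i j; rewrite !mxE !rev_ordK. Qed.

Lemma parity_rev (f : 'I_n -> bool) : parity (fun k => f (rev_ord k)) = parity f.
Proof. by rewrite /parity [RHS](reindex_inj rev_ord_inj). Qed.

Lemma parity_before_rev (f : 'I_n -> bool) j :
  parity_before (fun k => f (rev_ord k)) j
  = parity f (+) parity_before f (rev_ord j) (+) f (rev_ord j).
Proof.
rewrite -parity_before_suffix [RHS](reindex_inj rev_ord_inj) /parity_before /=.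
by apply: eq_bigl => k; move: (ltn_ord k) (ltn_ord j) => kn jn; apply/idP/idP; lia.
Qed.

(** A row of [rotm X] is a column of [X] read upwards. The column total being odd, the parity below
    an entry is the complement of the parity above it, the entry included. *)
Lemma lpar_rotm X i j : (forall j, parity (X^~ j)) ->
  lpar (rotm X) i j = ~~ (tpar X (rev_ord j) i (+) X (rev_ord j) i).
Proof.
move=> c; transitivity (parity_before (fun k => X (rev_ord k) i) j).
  by apply: eq_parity_before => k; rewrite mxE.
by rewrite (parity_before_rev (X^~ i)) c /tpar; case: (parity_before _ _); case: (X _ _).
Qed.

Lemma tpar_rotm X i j : tpar (rotm X) i j = lpar X (rev_ord j) i.
Proof. by apply: eq_parity_before => k; rewrite mxE. Qed.

Lemma valid_rotm X : valid (rotm X) = valid X.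
Proof.
have mk Y : valid Y -> valid (rotm Y).
  case/validP=> r c e; apply/validP; split.
  - move=> i; rewrite (@eq_parity _ _ (fun k => (Y^~ i) (rev_ord k))).
      by rewrite (parity_rev (Y^~ i)).
    by move=> k; rewrite mxE.
  - by move=> i; rewrite (@eq_parity _ _ (Y (rev_ord i))) // => k; rewrite mxE.
  move=> i j; rewrite mxE => x.
  by rewrite lpar_rotm // tpar_rotm e // x addbT negbK.
apply/idP/idP => [/mk/mk/mk|]; last exact: mk.
by have /= -> := rotm4 X.
Qed.

Lemma sum_rotm (R : nmodType) (F : 'M[bool]_n -> R) :
  \sum_(X | valid X) F X = \sum_(X | valid X) F (rotm X).
Proof.
rewrite (reindex_inj (can_inj rotm4)).
by apply: eq_bigl => X; rewrite valid_rotm.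
Qed.

End Valid.

Section Boundary.
Variable n : nat.
Implicit Type X : 'M[bool]_n.+1.

Lemma top_unique X : valid X -> exists p, X ord0 =1 pred1 p.
Proof.
case/validP=> r _ e; apply: line_unique => // j /e.
by rewrite /lpar /tpar parity_before0 => ->.
Qed.

Lemma rev_ord0 : rev_ord ord0 = ord_max :> 'I_n.+1.
Proof. by apply: val_inj; rewrite /= subn1. Qed.

Lemma rev_ord_max : rev_ord ord_max = ord0 :> 'I_n.+1.
Proof. by apply: val_inj; rewrite /= subnn. Qed.

Lemma left_unique X : valid X -> exists p, X^~ ord0 =1 pred1 p.
Proof.
rewrite -valid_tr => /top_unique[p Xp]; exists p => i.
by rewrite -Xp mxE.
Qed.

Lemma right_unique X : valid X -> exists p, X^~ ord_max =1 pred1 p.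
Proof.
rewrite -valid_rotm -valid_rotm -valid_rotm => /top_unique[p Xp].
exists p => i; rewrite -Xp !mxE rev_ord0; congr (X _ _).
by rewrite rev_ordK.
Qed.

Lemma bottom_unique X : valid X -> exists p, X ord_max =1 pred1 p.
Proof.
rewrite -valid_tr => /right_unique[p Xp]; exists p => i.
by rewrite -Xp mxE.
Qed.

Lemma lpar_left X i : lpar X i ord0 = false.
Proof. exact: parity_before0. Qed.

Lemma tpar_top X j : tpar X ord0 j = false.
Proof. exact: parity_before0. Qed.

Lemma lpar_right X i : valid X -> lpar X i ord_max = ~~ X i ord_max.
Proof. by case/validP=> r _ _; rewrite /lpar parity_before_max r. Qed.

Lemma tpar_bottom X j : valid X -> tpar X ord_max j = ~~ X ord_max j.
Proof. by case/validP=> _ c _; rewrite /tpar parity_before_max c. Qed.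

(* Exponents of z1, z2, z3, z4 in the quadruply refined generating function:
   each boundary line of a valid matrix has a single nonzero entry. *)
Definition expT X : nat := \sum_(j < n.+1) j * X ord0 j.
Definition expR X : nat := \sum_(i < n.+1) i * X i ord_max.
Definition expB X : nat := \sum_(j < n.+1) rev_ord j * X ord_max j.
Definition expL X : nat := \sum_(i < n.+1) rev_ord i * X i ord0.

Lemma sum_pred1 (f : 'I_n.+1 -> nat) (g : 'I_n.+1 -> bool) p :
  g =1 pred1 p -> (\sum_(j < n.+1) f j * g j = f p)%N.
Proof.
move=> gp; rewrite (bigD1 p) //= gp /= eqxx muln1 big1 ?addn0 // => j jp.
by rewrite gp /= (negbTE jp) muln0.
Qed.

Lemma expT_rotm X : expT (rotm X) = expL X.
Proof.
rewrite /expT /expL [RHS](reindex_inj rev_ord_inj).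
by apply: eq_bigr => j _; rewrite mxE rev_ordK.
Qed.

Lemma expR_rotm X : expR (rotm X) = expT X.
Proof. by apply: eq_bigr => j _; rewrite mxE rev_ord_max. Qed.

Lemma expB_rotm X : expB (rotm X) = expR X.
Proof.
rewrite /expB /expR [RHS](reindex_inj rev_ord_inj).
by apply: eq_bigr => j _; rewrite mxE.
Qed.

Lemma expL_rotm X : expL (rotm X) = expB X.
Proof. by apply: eq_bigr => j _; rewrite mxE rev_ord0. Qed.

End Boundary.

Section Corner.
Variable n : nat.

Definition add_corner (X : 'M[bool]_n) : 'M[bool]_n.+1 :=
  \matrix_(i, j) match unlift ord0 i, unlift ord0 j with
                 | Some i', Some j' => X i' j'
                 | None, None => true
                 | _, _ => false
                 end.

Definition del_corner (X : 'M[bool]_n.+1) : 'M[bool]_n :=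
  \matrix_(i, j) X (lift ord0 i) (lift ord0 j).

Lemma add_corner00 X : add_corner X ord0 ord0.
Proof. by rewrite mxE unlift_none. Qed.

Lemma add_corner0l X j : add_corner X ord0 (lift ord0 j) = false.
Proof. by rewrite mxE unlift_none liftK. Qed.

Lemma add_cornerl0 X i : add_corner X (lift ord0 i) ord0 = false.
Proof. by rewrite mxE unlift_none liftK. Qed.

Lemma add_cornerll X i j :
  add_corner X (lift ord0 i) (lift ord0 j) = X i j.
Proof. by rewrite mxE !liftK. Qed.

Definition add_cornerE :=
  (add_corner00, add_corner0l, add_cornerl0, add_cornerll).

Lemma add_cornerK : cancel add_corner del_corner.
Proof. by move=> X; apply/matrixP => i j; rewrite mxE add_cornerll. Qed.

(** The 1 at the corner is the only nonzero entry of the first row and of the first column, so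
    deleting both loses nothing. *)
Lemma del_cornerK X :
  valid X -> X ord0 ord0 -> add_corner (del_corner X) = X.
Proof.
move=> vX X00; apply/matrixP => i j.
have [p Xp] := top_unique vX; have [r Xr] := left_unique vX.
have := X00; rewrite Xp /= => /eqP p0.
have := X00; rewrite Xr /= => /eqP r0.
case: (unliftP ord0 i) => [i'|] ->; case: (unliftP ord0 j) => [j'|] ->;
  rewrite ?add_cornerE ?mxE //.
  by rewrite Xr /= -r0.
by rewrite Xp /= -p0.
Qed.

Lemma lpar_add_corner X i j :
  lpar (add_corner X) (lift ord0 i) (lift ord0 j) = lpar X i j.
Proof.
rewrite /lpar parity_before_recl add_cornerE.
by apply: eq_parity_before => k; rewrite add_cornerE.
Qed.

Lemma tpar_add_corner X i j :
  tpar (add_corner X) (lift ord0 i) (lift ord0 j) = tpar X i j.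
Proof.
rewrite /tpar parity_before_recl add_cornerE.
by apply: eq_parity_before => k; rewrite add_cornerE.
Qed.

Lemma valid_add_corner X : valid (add_corner X) = valid X.
Proof.
have rowl i : parity (add_corner X (lift ord0 i)) = parity (X i).
  by rewrite parity_recl add_cornerE; apply: eq_parity => k; rewrite add_cornerE.
have coll j : parity ((add_corner X)^~ (lift ord0 j)) = parity (X^~ j).
  by rewrite parity_recl add_cornerE; apply: eq_parity => k; rewrite add_cornerE.
apply/validP/validP => -[r c e]; split.
- by move=> i; rewrite -rowl.
- by move=> j; rewrite -coll.
- by move=> i j; rewrite -lpar_add_corner -tpar_add_corner => x;
    rewrite e ?add_cornerE.
- move=> i; case: (unliftP ord0 i) => [i'|] ->; first by rewrite rowl.
  rewrite parity_recl add_cornerE /parity big1 // => k _.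
  by rewrite add_cornerE.
- move=> i; case: (unliftP ord0 i) => [i'|] ->; first by rewrite coll.
  rewrite parity_recl add_cornerE /parity big1 // => k _.
  by rewrite add_cornerE.
move=> i j; case: (unliftP ord0 i) => [i'|] ->;
  case: (unliftP ord0 j) => [j'|] ->; rewrite ?add_cornerE //.
  by rewrite lpar_add_corner tpar_add_corner; apply: e.
by rewrite lpar_left tpar_top.
Qed.

Lemma sum_corner (R : nmodType) (F : 'M[bool]_n.+1 -> R) :
  \sum_(X | valid X && X ord0 ord0) F X
  = \sum_(X | valid X) F (add_corner X).
Proof.
rewrite (reindex_onto add_corner del_corner) => [|X /andP[]]; last first.
  exact: del_cornerK.
by apply: eq_bigl => X;
  rewrite valid_add_corner add_corner00 add_cornerK eqxx !andbT.
Qed.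

End Corner.

(** * Alternating sign matrices and their boundary statistics *)

(** Here [h] is the partial sum before the entry: a nonzero entry must bring it from 0 to 1 or from
    1 to 0. *)
Definition sg (h x : bool) : int := if x then if h then -1 else 1 else 0.

Fixpoint sgl (h : bool) (xs : seq bool) : seq int :=
  if xs is x :: xs' then sg h x :: sgl (h (+) x) xs' else [::].

Definition par (xs : seq bool) : bool := foldr addb false xs.

Notation alternates := (fun x y : int => y == - x).
Notation nonzero := (fun x : int => x != 0).

Lemma size_sgl h xs : size (sgl h xs) = size xs.
Proof. by elim: xs h => //= x xs IH h; rewrite IH. Qed.

Lemma nth_sgl h xs i :
  nth 0 (sgl h xs) i = sg (h (+) par (take i xs)) (nth false xs i).
Proof.
elim: xs h i => [|x xs IH] h [|i] //=; first by rewrite addbF.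
by rewrite IH addbA.
Qed.

Lemma sum_sgl h xs : \sum_(x <- sgl h xs) x = sg h (par xs).
Proof.
elim: xs h => [|x xs IH] h /=; first by rewrite big_nil.
by rewrite big_cons IH; case: h; case: x; case: (par xs).
Qed.

(** The seed of the path stands for the last nonzero entry read so far, which is 1 exactly when the
    partial sum [h] is 1. The seed -1 also serves for an empty prefix, since a line has to begin
    with 1. *)
Lemma path_sgl h xs :
  path alternates (if h then 1 else -1) [seq x <- sgl h xs | x != 0].
Proof.
elim: xs h => [|x xs IH] h //=; case: x => /=; last by rewrite addbF.
by have := IH (~~ h); case: h.
Qed.

Lemma path_sglE (e : int) s : e \in [:: 1; -1] -> {subset s <= [:: 0; 1; -1]} ->
  path alternates e [seq x <- s | x != 0] -> s = sgl (e == 1) (map nonzero s).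
Proof.
elim: s e => [|y s IH] e //= ee ss.
have s's : {subset s <= [:: 0; 1; -1]}.
  by move=> z zs; apply: ss; rewrite inE zs orbT.
have [-> /=|y0] := eqVneq y 0.
  by rewrite addbF => /(IH _ ee s's) <-.
rewrite /= => /andP[/eqP yE]; have y1 : y \in [:: 1; -1].
  by have := ss y (mem_head _ _); rewrite inE (negbTE y0).
move=> /(IH _ y1 s's) {1}->; rewrite addbT.
by move: ee y1; rewrite yE !inE => /orP[] /eqP ->.
Qed.

(** Alternation alone leaves the sign of the first nonzero entry free, whence the [h]; in
    [asm_lineP] the sum 1 forces it to be [false]. *)
Lemma sorted_sglE s : {subset s <= [:: 0; 1; -1]} ->
  sorted alternates [seq x <- s | x != 0] ->
  exists h, s = sgl h (map nonzero s).
Proof.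
elim: s => [|y s IH] /= ss; first by exists false.
have s's : {subset s <= [:: 0; 1; -1]}.
  by move=> z zs; apply: ss; rewrite inE zs orbT.
have [-> /=|y0] := eqVneq y 0.
  by move=> /(IH s's)[h sE]; exists h; rewrite addbF -sE.
have y1 : y \in [:: 1; -1].
  by have := ss y (mem_head _ _); rewrite inE (negbTE y0).
move=> /= /(path_sglE y1 s's) {1}->; exists (y == -1).
by move: y1; rewrite !inE => /orP[] /eqP ->.
Qed.

Lemma asm_lineP s : {subset s <= [:: 0; 1; -1]} ->
  asm_line s <-> s = sgl false (map nonzero s) /\ par (map nonzero s).
Proof.
move=> ss; split.
  case/andP=> /(sorted_sglE ss)[h sE]; rewrite {1}sE sum_sgl.
  by case: (par _); case: h sE.
case=> sE p; rewrite /asm_line sE sum_sgl p.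
by rewrite (path_sorted (path_sgl false _)).
Qed.

Lemma take_enum_ord n (j : 'I_n) :
  take j (enum 'I_n) = [seq k : 'I_n <- enum 'I_n | (k < j)%N].
Proof.
apply: (inj_map val_inj).
rewrite map_take val_enum_ord take_iota (minn_idPl (ltnW (ltn_ord j))).
rewrite -(filter_map val (fun k => (k < j)%N)) val_enum_ord.
by have := @filter_iota_ltn 0 n j (ltnW (ltn_ord j)); rewrite add0n => ->.
Qed.

Lemma par_big xs : par xs = \big[addb/false]_(x <- xs) x.
Proof. by rewrite /par foldrE. Qed.

Lemma par_enum n (f : 'I_n -> bool) : par (map f (enum 'I_n)) = parity f.
Proof. by rewrite par_big big_map big_enum. Qed.

Lemma par_take n (f : 'I_n -> bool) (j : 'I_n) :
  par (take j (map f (enum 'I_n))) = parity_before f j.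
Proof.
by rewrite -map_take take_enum_ord par_big big_map big_filter big_enum_cond.
Qed.

Lemma asm_line_ordP n (a : 'I_n -> int) :
  (forall j, a j \in [:: 0; 1; -1]) ->
  asm_line [seq a j | j <- enum 'I_n] <->
  (forall j, a j = sg (parity_before (fun k => a k != 0) j) (a j != 0))
  /\ parity (fun k => a k != 0).
Proof.
move=> aa; rewrite asm_lineP; last by move=> _ /mapP[j _ ->].
rewrite -map_comp par_enum; split=> -[aE ta]; split=> // {ta}.
  move=> j; have := congr1 (fun s => nth 0 s j) aE.
  rewrite nth_sgl par_take (nth_map j) ?size_enum_ord //.
  by rewrite (nth_map j) ?size_enum_ord // nth_ord_enum.
apply: (@eq_from_nth _ 0) => [|i]; first by rewrite size_sgl !size_map.
rewrite size_map size_enum_ord => lt_in; pose j := Ordinal lt_in.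
rewrite nth_sgl (par_take _ j) (nth_map j) ?size_enum_ord //.
by rewrite (nth_map j) ?size_enum_ord // -[i]/(val j) nth_ord_enum.
Qed.

Lemma sg_entry h x : sg h x \in [:: 0; 1; -1 : int].
Proof. by case: x => //; case: h. Qed.

Definition entry (h x : bool) : asm_entry := SeqSub (sg_entry h x).

Section Bijection.
Variable n : nat.

Definition supp (A : 'M[asm_entry]_n) : 'M[bool]_n :=
  \matrix_(i, j) (val (A i j) != 0).

Definition sgm (X : 'M[bool]_n) : 'M[asm_entry]_n :=
  \matrix_(i, j) entry (lpar X i j) (X i j).

Lemma sgmK X : supp (sgm X) = X.
Proof.
apply/matrixP => i j; rewrite !mxE /=.
by case: (X i j) => //; case: (lpar X i j).
Qed.

Lemma asm_rowsP (A : 'M[asm_entry]_n) :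
  reflect (forall i, asm_line [seq val (A i j) | j <- enum 'I_n])
          (all asm_line (asm_rows A)).
Proof.
rewrite all_map; apply: (iffP allP) => [h i|h i _ /=]; last exact: h.
by apply: h; rewrite mem_enum.
Qed.

(** The rows and the columns each determine the sign of every entry from the support; an ASM with a
    given support exists exactly when the two signs agree at each nonzero position. *)
Lemma is_asmE A : is_asm A = valid (supp A) && (sgm (supp A) == A).
Proof.
have aa (B : 'M[asm_entry]_n) i j : val (B i j) \in [:: 0; 1; -1 : int].
  exact: valP.
have suppE i j : (val (A i j) != 0) = supp A i j by rewrite mxE.
have trE i j : val (A^T i j) = val (A j i) by rewrite mxE.
apply/andP/andP=> [[/asm_rowsP rA /asm_rowsP cA]|[/validP[r c e] /eqP AE]].
  have {}rA i := (asm_line_ordP (aa A i)).1 (rA i).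
  have {}cA i := (asm_line_ordP (aa A^T i)).1 (cA i).
  have rE i j : val (A i j) = sg (lpar (supp A) i j) (supp A i j).
    by rewrite (rA i).1 suppE; congr sg; apply: eq_parity_before => k; rewrite suppE.
  have cE i j : val (A i j) = sg (tpar (supp A) i j) (supp A i j).
    rewrite -trE (cA j).1 trE suppE; congr sg.
    by apply: eq_parity_before => k; rewrite trE suppE.
  split.
    apply/validP; split=> [i|j|i j Xij].
    - by rewrite (eq_parity (fun k => esym (suppE i k))); case: (rA i).
    - rewrite (@eq_parity _ _ (fun k => val (A^T j k) != 0)); first by case: (cA j).
      by move=> k; rewrite trE suppE.
    have := cE i j; rewrite rE Xij.
    by case: (lpar _ _ _); case: (tpar _ _ _).
  by apply/eqP/matrixP => i j; apply: val_inj; rewrite mxE /= -rE.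
have rE i j : val (A i j) = sg (lpar (supp A) i j) (supp A i j).
  by rewrite -[in LHS]AE mxE.
split; apply/asm_rowsP => i; apply/asm_line_ordP => //; split=> [j|].
- by rewrite [LHS]rE suppE; congr sg; apply: eq_parity_before => k; rewrite suppE.
- by rewrite (eq_parity (suppE i)).
- rewrite trE [LHS]rE suppE /sg; case Xji: (supp A j i) => //.
  by rewrite e //; congr (if _ then _ else _); apply: eq_parity_before => k;
    rewrite trE suppE.
by rewrite (@eq_parity _ _ ((supp A)^~ i)) // => k; rewrite trE suppE.
Qed.

Lemma sum_ASM (R : nmodType) (F : 'M[asm_entry]_n -> R) :
  \sum_(A in ASM n) F A = \sum_(X | valid X) F (sgm X).
Proof.
rewrite (reindex_onto sgm supp) => [|A]; last first.
  by rewrite inE is_asmE => /andP[_ /eqP].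
apply: eq_bigl => X.
by rewrite inE is_asmE sgmK !eqxx !andbT.
Qed.

Lemma asm_numberE : asm_number n = #|[set X : 'M[bool]_n | valid X]|.
Proof.
rewrite /asm_number -!sum1_card sum_ASM.
by apply: eq_bigl => X; rewrite inE.
Qed.

End Bijection.

Lemma zeros_before_one_nseq p q :
  zeros_before_one (nseq p 0 ++ 1 :: nseq q 0) = p.
Proof.
rewrite /zeros_before_one index_cat mem_nseq andbF size_nseq /= addn0.
by rewrite take_size_cat ?size_nseq // count_nseq mul1n.
Qed.

Lemma pred1_nseq n (p : 'I_n.+1) :
  [seq ((j == p)%:Z : int) | j <- enum 'I_n.+1]
  = nseq p 0 ++ 1 :: nseq (rev_ord p) 0.
Proof.
apply: (@eq_from_nth _ 0).
  rewrite size_map size_enum_ord size_cat /= !size_nseq.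
  by have := ltn_ord p; lia.
move=> i; rewrite size_map size_enum_ord => lt_in; pose j := Ordinal lt_in.
rewrite (nth_map j) ?size_enum_ord //.
have -> : nth j (enum 'I_n.+1) i = j by apply: val_inj; rewrite /= nth_enum_ord.
rewrite nth_cat size_nseq nth_nseq -val_eqE /=.
case: (ltngtP i p) => [_|pi|->] //=; last by rewrite subnn.
by rewrite -[(i - p)%N]prednK ?subn_gt0 //= nth_nseq if_same.
Qed.

Lemma zeros_pred1 n (p : 'I_n.+1) :
  zeros_before_one [seq ((j == p)%:Z : int) | j <- enum 'I_n.+1] = p.
Proof. by rewrite pred1_nseq zeros_before_one_nseq. Qed.

Lemma zeros_rev_pred1 n (p : 'I_n.+1) :
  zeros_before_one (rev [seq ((j == p)%:Z : int) | j <- enum 'I_n.+1])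
  = rev_ord p.
Proof.
rewrite pred1_nseq rev_cat rev_cons !rev_nseq cat_rcons.
exact: zeros_before_one_nseq.
Qed.

Section Stats.
Variable n : nat.
Implicit Types (A : 'M[asm_entry]_n.+1) (X : 'M[bool]_n.+1).

Lemma head_rows A :
  head [::] (asm_rows A) = [seq val (A ord0 j) | j <- enum 'I_n.+1].
Proof. by rewrite /asm_rows enum_ordSl. Qed.

Lemma last_rows A :
  last [::] (asm_rows A) = [seq val (A ord_max j) | j <- enum 'I_n.+1].
Proof. by rewrite /asm_rows enum_ordSr map_rcons last_rcons. Qed.

Lemma boundary_sgm X i j : valid X ->
  (i == ord0) || (i == ord_max) || (j == ord0) || (j == ord_max) ->
  val (sgm X i j) = (X i j)%:Z.
Proof.
move=> vX b; rewrite mxE /= /sg; case Xij: (X i j) => //.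
suff -> : lpar X i j = false by [].
have [_ _ e] := validP _ vX.
case/orP: b => [/orP[/orP[]|]|] /eqP bE; subst.
- by rewrite e // tpar_top.
- by rewrite e // tpar_bottom // Xij.
- by rewrite lpar_left.
- by rewrite lpar_right // Xij.
Qed.

Lemma rhoT_sgm X : valid X -> rhoT (sgm X) = expT X.
Proof.
move=> vX; have [p Xp] := top_unique vX.
rewrite /expT (sum_pred1 _ Xp) -[RHS](zeros_pred1 p) /rhoT head_rows.
by congr zeros_before_one; apply: eq_map => j; rewrite boundary_sgm ?eqxx // Xp.
Qed.

Lemma rhoB_sgm X : valid X -> rhoB (sgm X) = expB X.
Proof.
move=> vX; have [p Xp] := bottom_unique vX.
rewrite /expB (sum_pred1 _ Xp) -[RHS](zeros_rev_pred1 p) /rhoB last_rows.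
congr (zeros_before_one (rev _)); apply: eq_map => j.
by rewrite boundary_sgm ?eqxx ?orbT // Xp.
Qed.

Lemma rhoL_sgm X : valid X -> (n.+1 - 1 - rhoL (sgm X) = expL X)%N.
Proof.
move=> vX; have [p Xp] := left_unique vX.
rewrite /expL (sum_pred1 _ Xp) subSS subn0 /=; congr (_ - _)%N.
rewrite -[RHS](zeros_pred1 p) /rhoL head_rows.
congr zeros_before_one; apply: eq_map => j.
by rewrite mxE boundary_sgm ?eqxx ?orbT // Xp.
Qed.

Lemma rhoR_sgm X : valid X -> (n.+1 - 1 - rhoR (sgm X) = expR X)%N.
Proof.
move=> vX; have [p Xp] := right_unique vX.
rewrite /expR (sum_pred1 _ Xp) subSS subn0.
have -> : rhoR (sgm X) = rev_ord p.
  rewrite -[RHS](zeros_rev_pred1 p) /rhoR last_rows.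
  congr (zeros_before_one (rev _)); apply: eq_map => j.
  by rewrite mxE boundary_sgm ?eqxx ?orbT // Xp.
by rewrite /= subSS subKn // -ltnS.
Qed.

Definition quad (R : comNzRingType) (z1 z2 z3 z4 : R) X :=
  z1 ^+ expT X * z2 ^+ expR X * z3 ^+ expB X * z4 ^+ expL X.

Lemma Zquad_altE (R : comNzRingType) (z1 z2 z3 z4 : R) :
  Zquad_alt n.+1 z1 z2 z3 z4 = \sum_(X | valid X) quad z1 z2 z3 z4 X.
Proof.
rewrite /Zquad_alt sum_ASM; apply: eq_bigr => X vX.
by rewrite rhoT_sgm // rhoB_sgm // rhoL_sgm // rhoR_sgm.
Qed.

Lemma ZoppE (R : comNzRingType) (z1 z3 : R) :
  Zopp n.+1 z1 z3 = \sum_(X | valid X) quad z1 1 z3 1 X.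
Proof.
rewrite /Zopp sum_ASM; apply: eq_bigr => X vX.
by rewrite /quad rhoT_sgm // rhoB_sgm // !expr1n !mulr1.
Qed.

End Stats.

(** * The six-vertex partition function *)

(** The Booleans [h] and [t] are the partial sums to the left and above. A nonzero entry whose row
    sign and column sign disagree has weight 0, so that sums can be extended to matrices that are
    not valid. *)
Definition vw (R : pzRingType) (al be u v : R) (h t x : bool) : R :=
  if x then if h == t then if h then u else v else 0
  else if h == t then al * u + be * v else be * u + al * v.

Definition Z6v (R : comNzRingType) (al be : R) n (u v : 'I_n -> R) : R :=
  \sum_(X : 'M[bool]_n | valid X) \prod_i \prod_j
    vw al be (u i) (v j) (lpar X i j) (tpar X i j) (X i j).

Section LineProducts.
Variables (R : comNzRingType) (n : nat).

Lemma prod_line (c b z : R) (p : 'I_n.+1) :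
  \prod_(j < n.+1) (if j == p then c else if (p < j)%N then b else b * z)
  = c * b ^+ n * z ^+ p.
Proof.
rewrite (bigD1 p) //= eqxx -mulrA; congr (_ * _).
rewrite (eq_bigr (fun j : 'I_n.+1 => b * (if (j < p)%N then z else 1))).
  rewrite big_split /= prodr_const cardC1 card_ord; congr (_ * _).
  rewrite -big_mkcondr /= (eq_bigl (fun j : 'I_n.+1 => (j < p)%N)).
    by rewrite -(big_ord_widen _ (fun=> z)) ?prodr_const ?card_ord // ltnW.
  by move=> j; rewrite -val_eqE /=; case: (ltngtP j p).
move=> j; rewrite -val_eqE /=.
by case: (ltngtP j p) => // _ _; rewrite mulr1.
Qed.

Lemma prod_line_rev (c b z : R) (p : 'I_n.+1) :
  \prod_(j < n.+1) (if j == p then c else if (p < j)%N then b * z else b)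
  = c * b ^+ n * z ^+ rev_ord p.
Proof.
rewrite -prod_line (reindex_inj rev_ord_inj); apply: eq_bigr => j _.
rewrite -(inj_eq rev_ord_inj) rev_ordK; case: eqP => // /eqP.
rewrite -val_eqE /= => jp.
have -> : (p < n.+1 - j.+1)%N = (j < n.+1 - p.+1)%N.
  by move: (ltn_ord p) (ltn_ord j); lia.
by move: jp; case: (ltngtP j (n.+1 - p.+1)%N).
Qed.

Lemma prod_row (i0 : 'I_n) (f : 'I_n -> 'I_n -> R) :
  \prod_i \prod_j (if i == i0 then f i j else 1) = \prod_j f i0 j.
Proof.
rewrite (bigD1 i0) //= eqxx [X in _ * X]big1 ?mulr1 // => i /negbTE->.
by rewrite big1.
Qed.

Lemma prod_col (j0 : 'I_n) (f : 'I_n -> 'I_n -> R) :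
  \prod_i \prod_j (if j == j0 then f i j else 1) = \prod_i f i j0.
Proof. by rewrite exchange_big (prod_row j0 (fun j i => f i j)). Qed.

Lemma prod_corners (k : 'I_n.+2 -> 'I_n.+2 -> R) :
  \prod_i \prod_j (if (i == ord0) || (i == ord_max) then
                     if (j == ord0) || (j == ord_max) then k i j else 1
                   else 1)
  = k ord0 ord0 * k ord0 ord_max * k ord_max ord_max * k ord_max ord0.
Proof.
have ends (f : 'I_n.+2 -> R) :
    \prod_i (if (i == ord0) || (i == ord_max) then f i else 1)
    = f ord0 * f ord_max.
  rewrite (bigD1 ord0) //= (bigD1 ord_max) //= eqxx big1 ?mulr1 // => i.
  by case/andP=> /negbTE-> /negbTE->.
rewrite (eq_bigr (fun i : 'I_n.+2 => if (i == ord0) || (i == ord_max) then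
    k i ord0 * k i ord_max else 1)); first by rewrite ends; ring.
by move=> i _; case: ifP => _; rewrite ?ends ?big1.
Qed.

End LineProducts.

Section Boundary.
Variables (R : comNzRingType) (al be : R) (n : nat).

(* The spectral parameters are 1 except on the two extreme lines. *)
Definition bd (a c : R) (i : 'I_n.+2) : R :=
  if i == ord0 then a else if i == ord_max then c else 1.

(** Off the extreme lines every weight is 1. On an extreme line the weight involves the parameter of
    that line only, except at a corner, where two special parameters meet: [d1], ..., [d4] are the
    quotients of the true weight of a corner zero by the product of its two line weights. A boundary
    1 has the weight of its column, hence the [b] and [d] on the vertical sides. *)
Lemma vw_bd (a b c d z1 z2 z3 z4 B1 B2 B3 B4 d1 d2 d3 d4 : R)
    (i0 im j0 jm h t x : bool) :
  al + be = 1 ->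
  be * a + al = B1 -> al * a + be = B1 * z1 ->
  al + be * d = B2 -> be + al * d = B2 * z2 ->
  be * c + al = B3 -> al * c + be = B3 * z3 ->
  al + be * b = B4 -> be + al * b = B4 * z4 ->
  al * a + be * b = d1 * (B1 * z1) * B4 ->
  be * a + al * d = d2 * (B2 * z2) * B1 ->
  al * c + be * d = d3 * (B3 * z3) * B2 ->
  be * c + al * b = d4 * (B4 * z4) * B3 ->
  ~~ (i0 && im) -> ~~ (j0 && jm) ->
  (i0 -> t = false) -> (im -> t = ~~ x) ->
  (j0 -> h = false) -> (jm -> h = ~~ x) -> (x -> h = t) ->
  vw al be (if i0 then a else if im then c else 1)
    (if j0 then b else if jm then d else 1) h t x
  = (if i0 then if x then 1 else if h then B1 else B1 * z1 else 1)
    * (if jm then if x then d else if t then B2 else B2 * z2 else 1)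
    * (if im then if x then 1 else if h then B3 * z3 else B3 else 1)
    * (if j0 then if x then b else if t then B4 * z4 else B4 else 1)
    * (if i0 || im then if j0 || jm then
         if x then 1 else
         if i0 then if j0 then d1 else d2 else if j0 then d4 else d3
       else 1 else 1).
Proof.
move=> E0 E1 E1' E2 E2' E3 E3' E4 E4' D1 D2 D3 D4.
case: i0; case: im => //= _; case: j0; case: jm => //= _;
  case: x => /= ti tm hj hm hx;
  rewrite ?(ti isT) ?(tm isT) ?(hj isT) ?(hm isT) ?(hx isT) ?mulr1 ?mul1r //=;
  rewrite /vw /= ?eqxx ?mulr1;
  first [by rewrite ?D1 ?D2 ?D3 ?D4; ring
        | by rewrite (ti isT)
        | by rewrite (tm isT)
        | by move: (hx isT) (hj isT) => <- ->
        | by move: (hx isT) (hm isT) => <- ->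
        | by case: (h) => /=
        | by case: (t) => /=
        | by rewrite [be + al]addrC E0 if_same ].
Qed.

Definition corners (d1 d2 d3 d4 : R) (X : 'M[bool]_n.+2) : R :=
  (if X ord0 ord0 then 1 else d1) * (if X ord0 ord_max then 1 else d2)
  * (if X ord_max ord_max then 1 else d3)
  * (if X ord_max ord0 then 1 else d4).

Lemma Z6v_bd (a b c d z1 z2 z3 z4 B1 B2 B3 B4 d1 d2 d3 d4 : R) :
  al + be = 1 ->
  be * a + al = B1 -> al * a + be = B1 * z1 ->
  al + be * d = B2 -> be + al * d = B2 * z2 ->
  be * c + al = B3 -> al * c + be = B3 * z3 ->
  al + be * b = B4 -> be + al * b = B4 * z4 ->
  al * a + be * b = d1 * (B1 * z1) * B4 ->
  be * a + al * d = d2 * (B2 * z2) * B1 ->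
  al * c + be * d = d3 * (B3 * z3) * B2 ->
  be * c + al * b = d4 * (B4 * z4) * B3 ->
  Z6v al be (bd a c) (bd b d)
  = b * d * (B1 * B2 * B3 * B4) ^+ n.+1 *
    \sum_(X : 'M[bool]_n.+2 | valid X)
      quad z1 z2 z3 z4 X * corners d1 d2 d3 d4 X.
Proof.
move=> E0 E1 E1' E2 E2' E3 E3' E4 E4' D1 D2 D3 D4.
rewrite /Z6v mulr_sumr; apply: eq_bigr => X vX.
have [_ _ e] := validP _ vX.
under eq_bigr => i _ do under eq_bigr => j _ do
  (rewrite (vw_bd E0 E1 E1' E2 E2' E3 E3' E4 E4' D1 D2 D3 D4);
   [|by case: eqP => // ->|by case: eqP => // ->
    |by move=> /eqP->; rewrite tpar_top
    |by move=> /eqP->; rewrite tpar_bottom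
    |by move=> /eqP->; rewrite lpar_left
    |by move=> /eqP->; rewrite lpar_right
    |exact: e]).
under eq_bigr => i _ do rewrite !big_split /=.
rewrite !big_split /=.
rewrite prod_row prod_col prod_row prod_col.
rewrite (prod_corners (fun i j => if X i j then 1 else
  if i == ord0 then if j == ord0 then d1 else d2
  else if j == ord0 then d4 else d3)) /=.
rewrite -/(corners d1 d2 d3 d4 X) mulrA; congr (_ * _).
have [p1 Xp1] := top_unique vX; have [p2 Xp2] := right_unique vX.
have [p3 Xp3] := bottom_unique vX; have [p4 Xp4] := left_unique vX.
rewrite /quad /expT (sum_pred1 _ Xp1) /expR (sum_pred1 _ Xp2).
rewrite /expB (sum_pred1 _ Xp3) /expL (sum_pred1 _ Xp4).
under eq_bigr => j _ do rewrite /lpar (eq_parity_before _ Xp1) parity_before_pred1 Xp1.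
under [X in _ * X * _ * _]eq_bigr => j _ do
  rewrite /tpar (eq_parity_before _ Xp2) parity_before_pred1 Xp2.
under [X in _ * X * _]eq_bigr => j _ do
  rewrite /lpar (eq_parity_before _ Xp3) parity_before_pred1 Xp3.
under [X in _ * X]eq_bigr => j _ do
  rewrite /tpar (eq_parity_before _ Xp4) parity_before_pred1 Xp4.
rewrite !prod_line !prod_line_rev !exprMn.
ring.
Qed.

End Boundary.

(** * Yang-Baxter equation and column symmetry *)

Lemma sum_ffun_recl (R : nmodType) n (F : {ffun 'I_n.+1 -> bool} -> R) :
  \sum_f F f = \sum_(b : bool) \sum_(f : {ffun 'I_n -> bool})
    F [ffun i => if unlift ord0 i is Some j then f j else b].
Proof.
rewrite pair_big /=.
pose cons (p : bool * {ffun 'I_n -> bool}) : {ffun 'I_n.+1 -> bool} :=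
  [ffun i => if unlift ord0 i is Some j then p.2 j else p.1].
rewrite (reindex cons) //=.
exists (fun f : {ffun 'I_n.+1 -> bool} =>
  (f ord0, [ffun i => f (lift ord0 i)])) => [[b f]|f] _ /=.
  congr pair; first by rewrite ffunE unlift_none.
  by apply/ffunP => i; rewrite !ffunE liftK.
by apply/ffunP => i; rewrite ffunE; case: unliftP => [j|] -> //=;
  rewrite ffunE.
Qed.

Section TwoColumns.
Variables (R : comNzRingType) (al be : R).

(** Partition function of two adjacent columns with fixed surroundings. Adding [c] to both columns
    changes the row states between them, but neither the state [h] on their left nor the one on
    their right. The partial sums start from [t0] and [t1] at the top and must be 1 at the
    bottom. *)
Definition col2 n (u : 'I_n -> R) (v0 v1 : R) (h x0 x1 : 'I_n -> bool)
    (t0 t1 : bool) : R :=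
  \sum_(c : {ffun 'I_n -> bool})
    (t0 (+) parity (fun i => x0 i (+) c i))%:R
    * (t1 (+) parity (fun i => x1 i (+) c i))%:R
    * \prod_i (vw al be (u i) v0 (h i)
                 (t0 (+) parity_before (fun i => x0 i (+) c i) i) (x0 i (+) c i)
               * vw al be (u i) v1 (h i (+) (x0 i (+) c i))
                 (t1 (+) parity_before (fun i => x1 i (+) c i) i) (x1 i (+) c i)).

Lemma col2_recl n (u : 'I_n.+1 -> R) v0 v1 h x0 x1 t0 t1 :
  col2 u v0 v1 h x0 x1 t0 t1
  = \sum_(b : bool)
      vw al be (u ord0) v0 (h ord0) t0 (x0 ord0 (+) b)
      * vw al be (u ord0) v1 (h ord0 (+) (x0 ord0 (+) b)) t1 (x1 ord0 (+) b)
      * col2 (fun i => u (lift ord0 i)) v0 v1 (fun i => h (lift ord0 i))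
          (fun i => x0 (lift ord0 i)) (fun i => x1 (lift ord0 i))
          (t0 (+) (x0 ord0 (+) b)) (t1 (+) (x1 ord0 (+) b)).
Proof.
rewrite /col2 sum_ffun_recl; apply: eq_bigr => b _.
rewrite mulr_sumr; apply: eq_bigr => c _.
set c' := finfun _.
have c'0 : c' ord0 = b by rewrite ffunE unlift_none.
have c'l i : c' (lift ord0 i) = c i by rewrite ffunE liftK.
rewrite !parity_recl big_ord_recl !parity_before0 !c'0 !addbF !addbA.
rewrite (eq_parity (fun i => congr1 (addb (x0 (lift ord0 i))) (c'l i))).
rewrite (eq_parity (fun i => congr1 (addb (x1 (lift ord0 i))) (c'l i))).
rewrite [RHS]mulrCA; congr (_ * (_ * _)); apply: eq_bigr => i _.
rewrite !parity_before_recl !c'0 !c'l !addbA.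
rewrite (eq_parity_before _ (fun k => congr1 (addb (x0 (lift ord0 k))) (c'l k))).
by rewrite (eq_parity_before _ (fun k => congr1 (addb (x1 (lift ord0 k))) (c'l k))).
Qed.

End TwoColumns.

Section YangBaxter.
Variables (K : fieldType) (q : K).
Hypotheses (hq : q ^+ 2 = q - 1) (h3 : 3 != 0 :> K).

(* The combinatorial point: alpha + beta = 1 and alpha * beta = 1 / 3, so that
   all weights are 1 when u = v = 1. *)
Definition alpha : K := (1 + q) / 3.
Definition beta : K := (2 - q) / 3.

Local Notation al := alpha.
Local Notation be := beta.

(* The Yang-Baxter equation, pushed through all rows: the vector of partial
   sums over two adjacent columns is intertwined by a six-vertex matrix. *)
Lemma yang_baxter n (u : 'I_n -> K) v0 v1 h x0 x1 :
  let y := be * v0 + al * v1 in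
  let S := col2 al be u v0 v1 h x0 x1 in
  let S' := col2 al be u v1 v0 h x0 x1 in
  [/\ y * S' false false = y * S false false,
      y * S' true true = y * S true true,
      y * S' false true
        = v1 * S false true + (al - be) * (v1 - v0) * S true false &
      y * S' true false
        = v0 * S true false + (al - be) * (v1 - v0) * S false true].
Proof.
move=> y; elim: n u h x0 x1 => [|n IH] u h x0 x1 S S'.
  have Z w0 w1 t0 t1 : col2 al be u w0 w1 h x0 x1 t0 t1 = (t0 && t1)%:R.
    rewrite /col2 (big_pred1 [ffun i => h i]) ?big_ord0; last first.
      by move=> c; apply/esym/eqP/ffunP => -[].
    rewrite /parity !big_ord0 !addbF mulr1.
    by case: t0; case: t1; rewrite ?mulr1 ?mulr0.
  by rewrite /S /S' !Z /=; split; ring.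
have yS t0 t1 : y * S' t0 t1 = _ := congr1 _ (col2_recl _ _ _ _ _ _ _ _ _ _).
have {}yS t0 t1 := etrans (yS t0 t1) (mulr_sumr _ _ _ _).
have SE t0 t1 : S t0 t1 = _ := col2_recl _ _ _ _ _ _ _ _ _ _.
have [I00 I11 I01 I10] := IH (fun i => u (lift ord0 i))
  (fun i => h (lift ord0 i)) (fun i => x0 (lift ord0 i))
  (fun i => x1 (lift ord0 i)).
(* What remains is the Yang-Baxter equation for a single row: for each state on the left and each
   pair of entries, a polynomial identity modulo the equation of [q]. *)
split; rewrite yS ?SE !big_bool; case: (h ord0); case: (x0 ord0);
  case: (x1 ord0); rewrite /vw /= ?mul0r ?mulr0 ?add0r ?addr0 //
    ?[y * (_ * _)]mulrCA ?I00 ?I11 ?I01 ?I10 /y /alpha /beta;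
  by field: hq.

Qed.
End YangBaxter.

Section ColumnWeights.
Variables (R : comNzRingType) (al be : R) (n : nat).

Definition colw (u : 'I_n -> R) (v : R) (X : 'M[bool]_n) (j : 'I_n) : R :=
  (parity (X^~ j))%:R
  * \prod_i vw al be (u i) v (lpar X i j) (tpar X i j) (X i j).

Definition rowp (X : 'M[bool]_n) : R := \prod_i (parity (X i))%:R.

(** Validity is spread over factors that vanish when it fails: row parities, column parities and the
    weight 0 in [vw]. The sum then runs over all Boolean matrices, a set that is stable under
    addition of a vector to two columns. *)
Lemma Z6v_colw u v :
  Z6v al be u v = \sum_X rowp X * \prod_j colw u (v j) X j.
Proof.
rewrite /Z6v big_mkcond; apply: eq_bigr => X _.
rewrite big_split /= exchange_big /=.
case: ifP => [/validP[r c _]|/negP nv].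
  rewrite /rowp [X in _ = X * _]big1 => [|i _]; last by rewrite r.
  rewrite [X in _ = _ * (X * _)]big1 => [|i _]; last by rewrite c.
  by rewrite !mul1r.
have [/forallP r|] := boolP [forall i, parity (X i)]; last first.
  rewrite negb_forall => /existsP[i /negbTE ri].
  by rewrite /rowp (bigD1 i) //= ri !mul0r.
have [/forallP c|] := boolP [forall j, parity (X^~ j)]; last first.
  rewrite negb_forall => /existsP[j /negbTE cj].
  by rewrite (bigD1 j (F := fun j => (parity (X^~ j))%:R)) //= cj !(mul0r, mulr0).
suff [i [j [x ne]]] : exists i j, X i j /\ lpar X i j != tpar X i j.
  set P := (Q in _ = _ * (_ * Q)); suff -> : P = 0 by rewrite !mulr0.
  by rewrite /P (bigD1 j) //= (bigD1 i) //= /vw x (negbTE ne) !mul0r.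
have [/existsP[i /existsP[j /andP[x ne]]]|ne] :=
  boolP [exists i, [exists j, X i j && (lpar X i j != tpar X i j)]].
  by exists i, j.
case: nv; apply/validP; split=> // i j x; apply/eqP.
move: ne; rewrite negb_exists => /forallP/(_ i).
by rewrite negb_exists => /forallP/(_ j); rewrite x /= negbK.
Qed.

End ColumnWeights.

Section Shift.
Variables (n : nat) (j0 j1 : 'I_n).
Hypothesis j01 : j1 = j0.+1 :> nat.

(** Each row receives [c i] twice, so its state changes only between the two columns. *)
Definition shift (c : {ffun 'I_n -> bool}) (X : 'M[bool]_n) : 'M[bool]_n :=
  \matrix_(i, k) (X i k (+) (((k == j0) || (k == j1)) && c i)).

Lemma neq_j01 : j0 != j1.
Proof. by rewrite -val_eqE /= j01 neq_ltn ltnSn. Qed.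

Lemma shiftK c : involutive (shift c).
Proof. by move=> X; apply/matrixP => i k; rewrite !mxE addbK. Qed.

Lemma pair_parity_before b k :
  parity_before (fun k : 'I_n => ((k == j0) || (k == j1)) && b) k = (k == j1) && b.
Proof.
rewrite (eq_parity_before (g := fun k => ((k == j0) && b) (+) ((k == j1) && b))).
  rewrite parity_beforeD; case: b => /=; last first.
    by rewrite /parity_before !big1 ?andbF // => i _; rewrite andbF.
  rewrite (eq_parity_before (g := pred1 j0)) => [|i]; last by rewrite /= andbT.
  rewrite [X in _ (+) X](eq_parity_before (g := pred1 j1)) => [|i];
    last by rewrite /= andbT.
  rewrite !parity_before_pred1 andbT -val_eqE /= j01.
  rewrite [(j0 < k)%N]leq_eqVlt eq_sym.
  by case: eqP => [->|_]; rewrite ?ltnn // addbb.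
move=> i; case: b; rewrite ?andbF // !andbT.
by case: (eqVneq i j0) => [->|]; rewrite ?(negbTE neq_j01).
Qed.

Lemma lpar_shift c X i k :
  lpar (shift c X) i k = lpar X i k (+) ((k == j1) && c i).
Proof. by rewrite /lpar -pair_parity_before -parity_beforeD; apply: eq_parity_before => l; rewrite mxE. Qed.

Lemma lpar_j1 X i : lpar X i j1 = lpar X i j0 (+) X i j0.
Proof. exact: parity_before_next. Qed.

Lemma parity_shift c X i : parity (shift c X i) = parity (X i).
Proof.
rewrite (@eq_parity _ _ (fun k => X i k (+) (((k == j0) || (k == j1)) && c i))).
  rewrite parityD [X in _ (+) X](_ : _ = false) ?addbF //.
  rewrite /parity (bigD1 j0) //= (bigD1 j1) //=; last by rewrite eq_sym neq_j01.
  rewrite !eqxx orbT big1 ?addbF ?addbb // => k /andP[/negbTE-> /negbTE->].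
  by [].
by move=> k; rewrite mxE.
Qed.

End Shift.

Section Swap.
Variables (K : fieldType) (q : K).
Hypotheses (hq : q ^+ 2 = q - 1) (hchar : [pchar K] =i pred0).
Local Notation al := (alpha q).
Local Notation be := (beta q).

Lemma char3 : 3 != 0 :> K.
Proof. by rewrite (pcharf0P K).1. Qed.

(* Adding the same vector c to two adjacent columns only affects the weights
   of these columns, so it suffices to compare averages over c. *)
Lemma Z6v_swap n (u v : 'I_n -> K) (j0 j1 : 'I_n) : j1 = j0.+1 :> nat ->
  be * v j0 + al * v j1 != 0 ->
  Z6v al be u (fun j => v (tperm j0 j1 j)) = Z6v al be u v.
Proof.
move=> j01 y0; apply: (mulfI y0); rewrite !Z6v_colw.
(* Averaging over all [c] counts every matrix 2^n times, a factor that is invertible in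
   characteristic 0. *)
set N := #|{ffun 'I_n -> bool}|; have N0 : N%:R != 0 :> K.
  by rewrite (pcharf0P K).1 // /N card_ffun card_bool card_ord expn_eq0.
apply: (mulfI N0).
have avg (F : 'M[bool]_n -> K) :
    N%:R * \sum_X F X = \sum_X \sum_(c : {ffun 'I_n -> bool}) F (shift j0 j1 c X).
  rewrite exchange_big /= [RHS](eq_bigr (fun=> \sum_X F X)) => [|c _]; last first.
    by rewrite [RHS](reindex_inj (inv_inj (shiftK j0 j1 c))).
  by rewrite sumr_const mulr_natl.
rewrite ![N%:R * (_ * _)]mulrCA !avg !mulr_sumr.
apply: eq_bigr => X _.
set h := fun i => lpar X i j0; set x0 := X^~ j0; set x1 := X^~ j1.
have col2E v0 v1 : \sum_(c : {ffun 'I_n -> bool})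
     colw al be u v0 (shift j0 j1 c X) j0 * colw al be u v1 (shift j0 j1 c X) j1
   = col2 al be u v0 v1 h x0 x1 false false.
  apply: eq_bigr => c _; rewrite /colw mulrACA -big_split /=.
  have s0 i : shift j0 j1 c X i j0 = x0 i (+) c i by rewrite mxE eqxx.
  have s1 i : shift j0 j1 c X i j1 = x1 i (+) c i by rewrite mxE eqxx orbT.
  rewrite (eq_parity s0) (eq_parity s1); congr (_ * _).
  apply: eq_bigr => i _; rewrite s0 s1 /tpar (eq_parity_before _ s0) (eq_parity_before _ s1).
  rewrite !(lpar_shift j01) eqxx (negbTE (neq_j01 j01)) addbF (lpar_j1 j01).
  by rewrite addbA.
pose rest := \prod_(k | (k != j0) && (k != j1)) colw al be u (v k) X k.
have splitE (w : 'I_n -> K) : (forall k, k != j0 -> k != j1 -> w k = v k) ->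
    \sum_(c : {ffun 'I_n -> bool}) rowp K (shift j0 j1 c X)
      * \prod_j colw al be u (w j) (shift j0 j1 c X) j
    = rowp K X * rest * col2 al be u (w j0) (w j1) h x0 x1 false false.
  move=> wE; rewrite -col2E mulr_sumr; apply: eq_bigr => c _.
  have -> : rowp K (shift j0 j1 c X) = rowp K X.
    by apply: eq_bigr => i _; rewrite (parity_shift j01).
  rewrite -mulrA; congr (_ * _); rewrite (bigD1 j0) //= (bigD1 j1) /=; last first.
    by rewrite eq_sym neq_j01.
  rewrite [LHS]mulrA [LHS]mulrC; congr (_ * _); apply: eq_bigr => k /andP[k0 k1].
  have sk i : shift j0 j1 c X i k = X i k.
    by rewrite mxE (negbTE k0) (negbTE k1) addbF.
  rewrite wE // /colw (eq_parity sk); congr (_ * _); apply: eq_bigr => i _.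
  by rewrite sk (lpar_shift j01) (negbTE k1) addbF /tpar (eq_parity_before _ sk).
rewrite !splitE // ?tpermL ?tpermR; last first.
  by move=> k k0 k1; rewrite tpermD // eq_sym.
(* At the top both columns have partial sum 0, a state on which the intertwining matrix acts as a
   scalar. *)
have [yb _ _ _] := yang_baxter hq char3 u (v j0) (v j1) h x0 x1.
by rewrite mulrCA yb mulrCA.
Qed.

End Swap.

(** * The Izergin-Korepin determinant *)

Definition vcons (T : Type) n (x : T) (u : 'I_n -> T) : 'I_n.+1 -> T :=
  fun i => if unlift ord0 i is Some j then u j else x.

Lemma vcons0 T n (x : T) (u : 'I_n -> T) : vcons x u ord0 = x.
Proof. by rewrite /vcons unlift_none. Qed.

Lemma vconsl T n (x : T) (u : 'I_n -> T) i : vcons x u (lift ord0 i) = u i.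
Proof. by rewrite /vcons liftK. Qed.

Lemma eq_Z6v (R : comNzRingType) (al be : R) n (u u' v v' : 'I_n -> R) :
  u =1 u' -> v =1 v' -> Z6v al be u v = Z6v al be u' v'.
Proof.
move=> uu vv; apply: eq_bigr => X _; apply: eq_bigr => i _.
by apply: eq_bigr => j _; rewrite uu vv.
Qed.

Lemma rmorph_Z6v (R S : comNzRingType) (f : {rmorphism R -> S}) (al be : R) n
    (u v : 'I_n -> R) :
  f (Z6v al be u v) = Z6v (f al) (f be) (f \o u) (f \o v).
Proof.
rewrite rmorph_sum; apply: eq_bigr => X _.
rewrite rmorph_prod; apply: eq_bigr => i _.
rewrite rmorph_prod; apply: eq_bigr => j _.
rewrite /vw; case: (X i j).
  by case: ifP => _; rewrite ?rmorph0 //; case: ifP.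
by case: ifP => _; rewrite rmorphD !rmorphM.
Qed.

(* When the corner cannot carry a zero, it carries a 1, and the rest of its
   row and column is frozen. *)
Lemma Z6v_freeze (R : comNzRingType) (al be : R) n (u v : 'I_n -> R) x y :
  al * x + be * y = 0 ->
  Z6v al be (vcons x u) (vcons y v)
  = y * (\prod_j (be * x + al * v j)) * (\prod_i (be * u i + al * y))
    * Z6v al be u v.
Proof.
move=> c0; rewrite /Z6v (bigID (fun X : 'M[bool]_n.+1 => X ord0 ord0)) /=.
rewrite [X in _ + X]big1 ?addr0 => [|X /andP[_ /negbTE X00]]; last first.
  rewrite (bigD1 ord0) //= (bigD1 ord0) //= X00 lpar_left tpar_top !vcons0.
  by rewrite /vw /= c0 !mul0r.
rewrite sum_corner mulr_sumr; apply: eq_bigr => X vX.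
rewrite big_ord_recl [X in X * _]big_ord_recl vcons0 vcons0.
rewrite add_corner00 lpar_left tpar_top {1}/vw /= -!mulrA; congr (_ * _).
have lp0 j : lpar (add_corner X) ord0 (lift ord0 j) = true.
  rewrite /lpar parity_before_recl add_cornerE /parity_before big1 // => k _.
  by rewrite add_cornerE.
have tp0 i : tpar (add_corner X) (lift ord0 i) ord0 = true.
  rewrite /tpar parity_before_recl add_cornerE /parity_before big1 // => k _.
  by rewrite add_cornerE.
congr (_ * _).
  by apply: eq_bigr => j _; rewrite add_cornerE tpar_top lp0 vconsl.
rewrite -big_split /=; apply: eq_bigr => i _.
rewrite big_ord_recl add_cornerE lpar_left tp0 vconsl vcons0; congr (_ * _).
apply: eq_bigr => j _.
by rewrite add_cornerE lpar_add_corner tpar_add_corner !vconsl.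
Qed.

Lemma size_prod_le (R : comNzRingType) (I : finType) (F : I -> {poly R})
    (d : I -> nat) :
  (forall i, size (F i) <= (d i).+1)%N ->
  (size (\prod_i F i)%R <= (\sum_i d i).+1)%N.
Proof.
move=> Fd; elim/big_ind2: _ => [|p m p' m' pm pm'|//].
  by rewrite size_poly1.
by apply: leq_trans (size_polyMleq _ _) _; move: pm pm'; lia.
Qed.

Lemma size_lin (R : nzRingType) (a b : R) :
  (size (a%:P * 'X + b%:P)%R <= 2)%N.
Proof.
rewrite (leq_trans (size_polyD _ _)) // geq_max; apply/andP; split.
  rewrite mul_polyC (leq_trans (size_scale_leq _ _)) //.
  by rewrite size_polyX.
by rewrite (leq_trans (size_polyC_leq1 _)).
Qed.

Section TopRowPolynomial.
Variables (R : comNzRingType) (al be : R) (n : nat).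
Variables (u : 'I_n -> R) (v : 'I_n.+1 -> R).

Definition Zpoly : {poly R} :=
  Z6v al%:P be%:P (vcons 'X (fun i => (u i)%:P)) (fun j => (v j)%:P).

Lemma horner_Zpoly x : Zpoly.[x] = Z6v al be (vcons x u) v.
Proof.
rewrite -/(horner_eval x _) rmorph_Z6v /= !horner_evalE !hornerC.
apply: eq_Z6v => i /=; rewrite horner_evalE ?hornerC //.
by rewrite /vcons; case: unliftP => *; rewrite ?hornerC ?hornerX.
Qed.

(** The only nonzero entry of the top row is a 1, weighted by its column parameter; each of the [n]
    zeros of that row has a weight of degree at most 1. *)
Lemma size_Zpoly : (size Zpoly <= n.+1)%N.
Proof.
apply: (leq_trans (size_sum _ _ _)); apply/bigmax_leqP => X vX.
have [p Xp] := top_unique vX.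
rewrite big_ord_recl.
have s0 : (size (\prod_j vw al%:P be%:P (vcons 'X (fun i => (u i)%:P) ord0)
    (v j)%:P (lpar X ord0 j) (tpar X ord0 j) (X ord0 j))%R <= n.+1)%N.
  have nE : n = (\sum_(j < n.+1) (j != p))%N.
    rewrite (bigD1 p) //= eqxx add0n (eq_bigr (fun=> 1%N)) => [|j ->//].
    by rewrite sum_nat_const cardC1 card_ord muln1.
  rewrite [X in (_ <= X.+1)%N]nE.
  apply: size_prod_le => j; rewrite vcons0 tpar_top /vw Xp /=.
  case: eqP => [->|_] /=.
    have [_ _ e] := validP _ vX.
    have -> : lpar X ord0 p = false by rewrite e ?tpar_top // Xp /= eqxx.
    by rewrite size_polyC_leq1.
  by rewrite -!polyCM; case: ifP => _; rewrite size_lin.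
set rest := \prod_(i < n) _; suff r1 : (size rest <= 1)%N.
  by apply: leq_trans (size_polyMleq _ _) _; rewrite -subn1 leq_subLR addnC leq_add.
have sz d (F : 'I_d -> {poly R}) : (forall i, size (F i) <= 1)%N ->
    (size (\prod_i F i)%R <= 1)%N.
  move=> F1; apply: leq_trans (@size_prod_le _ _ F (fun=> 0%N) F1) _.
  by rewrite big1.
apply: (sz _ _) => i; apply: (sz _ _) => j; rewrite vconsl /vw.
by case: (X _ _); [case: ifP => _; [case: ifP => _|]|case: ifP => _];
  rewrite -?polyCM -?polyCD ?size_poly0 ?size_polyC_leq1.
Qed.
End TopRowPolynomial.

(** For distinct [a] and [b] this is [(a ^+ 3 - b ^+ 3) / (a - b)]. By [s3_factor] it is also 3
    times the product of the two weights of a zero. *)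
Definition s3 (R : pzRingType) (a b : R) : R := a ^+ 2 + a * b + b ^+ 2.

Definition Vdm (R : comNzRingType) n (u : 'I_n -> R) : R :=
  \det (Vandermonde n (\row_i u i)).

Definition Nmx (K : fieldType) n (u v : 'I_n -> K) : 'M[K]_n :=
  \matrix_(i, j) (s3 (u i) (v j))^-1.

(** Distinct cubes make every [s3 (u i) (v j)] nonzero, as well as the Vandermonde determinants of
    the parameters and of their cubes. *)
Definition generic (K : fieldType) m n (u : 'I_m -> K) (v : 'I_n -> K) : Prop :=
  [/\ injective (fun i => u i ^+ 3), injective (fun j => v j ^+ 3) &
      forall i j, u i ^+ 3 != v j ^+ 3].

Lemma det_col_perm (R : comNzRingType) n (s : 'S_n) (A : 'M[R]_n) :
  \det (col_perm s A) = (-1) ^+ s * \det A.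
Proof. by rewrite col_permE det_mulmx det_perm odd_permV mulrC. Qed.

Lemma Vdm_perm (R : comNzRingType) n (s : 'S_n) (u : 'I_n -> R) :
  Vdm (fun i => u (s i)) = (-1) ^+ s * Vdm u.
Proof.
rewrite /Vdm -det_col_perm; congr determinant.
by apply/matrixP => i j; rewrite !mxE.
Qed.

Lemma Vdm_recl (R : comNzRingType) n (u : 'I_n.+1 -> R) :
  Vdm u = (\prod_i (u (lift ord0 i) - u ord0)) * Vdm (fun i => u (lift ord0 i)).
Proof.
rewrite /Vdm !det_Vandermonde big_ord_recl; congr (_ * _).
  rewrite big_mkcond big_ord_recl /= mul1r.
  by apply: eq_bigr => i _; rewrite !mxE.
apply: eq_bigr => i _; rewrite big_mkcond big_ord_recl /= mul1r.
by rewrite -big_mkcond /=; apply: eq_bigr => j _; rewrite !mxE.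
Qed.

Section IzerginKorepin.
Variables (K : fieldType) (q : K).
Hypotheses (hq : q ^+ 2 = q - 1) (hchar : [pchar K] =i pred0).
Local Notation al := (alpha q).
Local Notation be := (beta q).
Let h3 : 3 != 0 :> K := char3 hchar.

Lemma s3_neq0 (a b : K) : a ^+ 3 != b ^+ 3 -> s3 a b != 0.
Proof.
apply: contra_neq => s0; apply/eqP; rewrite -subr_eq0.
have -> : a ^+ 3 - b ^+ 3 = (a - b) * s3 a b by rewrite /s3; ring.
by rewrite s0 mulr0.
Qed.

Lemma s3_factor (a b : K) : s3 a b = 3 * (be * a + al * b) * (al * a + be * b).
Proof. by rewrite /s3 /beta /alpha; field: hq. Qed.

Lemma bar_neq0 (a b : K) : a ^+ 3 != b ^+ 3 -> be * a + al * b != 0.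
Proof.
move/s3_neq0; rewrite s3_factor; apply: contra_neq => ->.
by rewrite mulr0 mul0r.
Qed.

(* The zero of the weight al * x + be * v, as a multiple of v. *)
Let r := q - 1.

Lemma s3_root (v : K) : s3 (r * v) v = 0.
Proof. by rewrite /s3 /r; ring: hq. Qed.

Lemma al_root (v : K) : al * (r * v) + be * v = 0.
Proof. by rewrite /r /alpha /beta; field: hq. Qed.

Lemma r_neq0 : r != 0.
Proof.
have : r * r ^+ 2 = 1 by rewrite /r; ring: hq.
by apply: contra_eq_neq => ->; rewrite mul0r eq_sym oner_neq0.
Qed.

(** The passage from size [n] to size [n.+1] contributes [3^-1 ^+ n], because
    [3 * al * (3 * be) = 3]; the exponents add up to a binomial coefficient. *)
Definition kappa n : K := 3^-1 ^+ 'C(n, 2).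

Section Step.
Variables (n : nat) (u : 'I_n -> K).
Implicit Type v : 'I_n.+1 -> K.

(** The matrix [Nmx (vcons x u) v] with its top row multiplied by all the [s3 x (v k)]: it is
    polynomial in [x] and can be evaluated where one of these factors vanishes. *)
Definition topmx v (x : K) : 'M[K]_n.+1 :=
  \matrix_(i, j) if unlift ord0 i is Some i' then (s3 (u i') (v j))^-1
                 else \prod_(k | k != j) s3 x (v k).

Definition topmxX v : 'M[{poly K}]_n.+1 :=
  \matrix_(i, j) if unlift ord0 i is Some i' then (s3 (u i') (v j))^-1%:P
                 else \prod_(k | k != j) s3 'X (v k)%:P.

Definition coef v : K :=
  kappa n.+1 * \prod_j v j * \prod_i \prod_j s3 (u i) (v j).

Definition Rpoly v : {poly K} := (coef v)%:P * \det (topmxX v).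

(* As polynomials of degree at most 2n in the top spectral parameter, both sides
   of the determinant formula agree at the n.+1 zeros r * v j of the weights
   and vanish at the n remaining spectral parameters u i. *)
Definition Lpoly v : {poly K} :=
  Zpoly al be u v * \prod_i ((u i)%:P - 'X) * (Vdm u * Vdm v)%:P.

Lemma horner_Rpoly v x : (Rpoly v).[x] = coef v * \det (topmx v x).
Proof.
rewrite /Rpoly hornerM hornerC; congr (_ * _).
rewrite -[LHS]horner_evalE -det_map_mx; congr determinant.
apply/matrixP => i j; rewrite !mxE.
case: (unlift ord0 i) => [i'|]; first by rewrite /= /horner_eval hornerC.
by rewrite rmorph_prod; apply: eq_bigr => k _; rewrite /= /horner_eval /s3 !hornerE.
Qed.

Lemma horner_Lpoly v x : (Lpoly v).[x]
  = Z6v al be (vcons x u) v * \prod_i (u i - x) * (Vdm u * Vdm v).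
Proof.
rewrite /Lpoly !hornerM hornerC horner_Zpoly horner_prod; congr (_ * _ * _).
by apply: eq_bigr => i _; rewrite !hornerE.
Qed.

Lemma coef_perm v (s : 'S_n.+1) : coef (fun j => v (s j)) = coef v.
Proof.
rewrite /coef [\prod_j v j](reindex_inj (@perm_inj _ s)) /=; congr (_ * _).
by apply: eq_bigr => i _; rewrite [RHS](reindex_inj (@perm_inj _ s)).
Qed.

Lemma topmx_perm v (s : 'S_n.+1) x :
  \det (topmx (fun j => v (s j)) x) = (-1) ^+ s * \det (topmx v x).
Proof.
rewrite -det_col_perm; congr determinant; apply/matrixP => i j; rewrite !mxE.
case: (unlift ord0 i) => // .
rewrite [RHS](reindex_inj (@perm_inj _ s)); apply: eq_bigl => k.
by rewrite (inj_eq perm_inj).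
Qed.

Lemma det_topmx v x : (forall j, s3 x (v j) != 0) ->
  \det (topmx v x) = \prod_j s3 x (v j) * \det (Nmx (vcons x u) v).
Proof.
move=> s0; rewrite !(expand_det_row _ ord0) mulr_sumr.
apply: eq_bigr => j _; rewrite [RHS]mulrA; congr (_ * _).
  rewrite !mxE unlift_none vcons0 (bigD1 (P := predT) j) //=.
  by rewrite mulrAC mulfV ?mul1r.
congr (_ * \det _); apply/matrixP => i k; rewrite !mxE liftK vconsl //.
Qed.

Lemma size_s3 (a : K) : (size (s3 'X a%:P) <= 3)%N.
Proof.
have -> : s3 'X a%:P = 'X^2 + (a%:P * 'X + (a ^+ 2)%:P).
  by rewrite /s3 polyC_exp; ring.
rewrite (leq_trans (size_polyD _ _)) // size_polyXn geq_max leqnn /=.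
by rewrite (leq_trans (size_lin _ _)).
Qed.

Lemma size_Rpoly v : (size (Rpoly v) <= (n + n).+1)%N.
Proof.
rewrite /Rpoly mul_polyC (leq_trans (size_scale_leq _ _)) //.
rewrite (expand_det_row _ ord0); apply: (leq_trans (size_sum _ _ _)).
apply/bigmax_leqP => j _; rewrite mxE unlift_none.
have -> : cofactor (topmxX v) ord0 j = (cofactor (topmx v 0) ord0 j)%:P.
  rewrite /cofactor polyCM polyC_exp polyCN; congr (_ * _).
  rewrite -det_map_mx; congr determinant.
  by apply/matrixP => i k; rewrite !mxE liftK.
rewrite mulrC mul_polyC (leq_trans (size_scale_leq _ _)) //.
rewrite big_mkcond /=.
apply: leq_trans (size_prod_le (d := fun k => (k != j).*2) _) _.
  by move=> k; case: (k != j); rewrite ?size_poly1 // size_s3.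
rewrite (bigD1 j) //= eqxx add0n (eq_bigr (fun=> 2%N)) => [|k ->//].
by rewrite sum_nat_const cardC1 card_ord muln2 addnn.
Qed.

Lemma size_Lpoly v : (size (Lpoly v) <= (n + n).+1)%N.
Proof.
rewrite /Lpoly mulrC mul_polyC (leq_trans (size_scale_leq _ _)) //.
apply: leq_trans (size_polyMleq _ _) _.
have sP : (size (\prod_(i < n) ((u i)%:P - 'X))%R <= n.+1)%N.
  apply: leq_trans (size_prod_le (d := fun=> 1%N) _) _.
    move=> i; rewrite (leq_trans (size_polyD _ _)) // size_polyN size_polyX.
    by rewrite geq_max (leq_trans (size_polyC_leq1 _)).
  by rewrite sum_nat_const card_ord muln1.
rewrite -subn1 leq_subLR (leq_trans (leq_add (size_Zpoly al be u v) sP)) //.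
by rewrite addSn addnS add1n.
Qed.

Lemma Lpoly_tperm v (j0 j1 : 'I_n.+1) x : j1 = j0.+1 :> nat ->
  injective (fun j => v j ^+ 3) ->
  (Lpoly (fun j => v (tperm j0 j1 j))).[x] = - (Lpoly v).[x].
Proof.
move=> j01 v_inj; have ne := neq_j01 j01.
rewrite !horner_Lpoly Vdm_perm odd_tperm ne expr1 mulN1r !mulrN.
rewrite Z6v_swap // bar_neq0 //.
by apply: contra_neq ne => /v_inj.
Qed.

Lemma Rpoly_tperm v (j0 j1 : 'I_n.+1) x : j0 != j1 ->
  (Rpoly (fun j => v (tperm j0 j1 j))).[x] = - (Rpoly v).[x].
Proof.
move=> ne; rewrite !horner_Rpoly coef_perm topmx_perm odd_tperm ne expr1.
by rewrite mulN1r mulrN.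
Qed.

Hypothesis IH : forall v' : 'I_n -> K, generic u v' ->
  Z6v al be u v' * Vdm u * Vdm v'
  = kappa n * \prod_j v' j * \prod_i \prod_j s3 (u i) (v' j) * \det (Nmx u v').

(** At this value a zero in the top left corner has weight 0, so the partition function freezes to
    size [n]. On the right, every entry of the top row but the first contains the factor
    [s3 (r * v ord0) (v ord0)], which is 0, and the remaining minor is the determinant of size
    [n]. *)
Lemma poly_root0 v : generic u (fun j => v (lift ord0 j)) ->
  (Lpoly v).[r * v ord0] = (Rpoly v).[r * v ord0].
Proof.
move=> g; rewrite horner_Lpoly horner_Rpoly.
pose vl j := v (lift ord0 j); have IHv := IH g.
rewrite (@eq_Z6v _ _ _ _ _ (vcons (r * v ord0) u) _ (vcons (v ord0) vl)) //;
  last first.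
  by move=> j; rewrite /vcons; case: unliftP => [k|] ->.
rewrite Z6v_freeze ?al_root // Vdm_recl -/vl.
rewrite (expand_det_row _ ord0) big_ord_recl [X in _ + X]big1 ?addr0; last first.
  move=> j _; rewrite !mxE unlift_none (bigD1 ord0) //= s3_root.
  by rewrite !mul0r.
rewrite mxE unlift_none /cofactor addn0 expr0 mul1r.
have -> : row' ord0 (col' ord0 (topmx v (r * v ord0))) = Nmx u vl.
  by apply/matrixP => i j; rewrite !mxE liftK.
rewrite [X in _ = _ * (X * _)]big_mkcond [X in _ = _ * (X * _)]big_ord_recl.
rewrite eqxx /= mul1r.
rewrite /coef big_ord_recl.
under [\prod_i \prod_j s3 _ _]eq_bigr => i _ do rewrite big_ord_recl.
rewrite big_split /=.
rewrite /kappa binS bin1 exprD.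
have ab : 3 * al * (3 * be) = 3 by rewrite /alpha /beta; field: hq.
have a0 : 3 * al != 0 by apply: contraNneq h3 => a0; rewrite -ab a0 mul0r.
have b0 : 3 * be != 0 by apply: contraNneq h3 => b0; rewrite -ab b0 mulr0.
have cX (c : K) : c ^+ n = \prod_(i < n) c.
  by rewrite prodr_const card_ord.
have E1 : (\prod_j (be * (r * v ord0) + al * vl j)) * \prod_j (vl j - v ord0)
   = \prod_(j < n) (s3 (r * v ord0) (vl j)) * (3 * be)^-1 ^+ n.
  rewrite cX -!big_split /=.
  apply: eq_bigr => j _; apply: (canRL (mulfK b0)).
  by rewrite s3_factor /r /alpha /beta; field: hq.
have E2 : (\prod_i (be * u i + al * v ord0)) * \prod_i (u i - r * v ord0)
   = \prod_(i < n) (s3 (u i) (v ord0)) * (3 * al)^-1 ^+ n.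
  rewrite cX -!big_split /=.
  apply: eq_bigr => j _; apply: (canRL (mulfK a0)).
  by rewrite s3_factor /r /alpha /beta; field: hq.
have E3 : (3 * be)^-1 ^+ n * (3 * al)^-1 ^+ n = 3^-1 ^+ n :> K.
  by rewrite -exprMn -invfM [3 * be * _]mulrC ab.
transitivity (v ord0
  * ((\prod_j (be * (r * v ord0) + al * vl j)) * \prod_j (vl j - v ord0))
  * ((\prod_i (be * u i + al * v ord0)) * \prod_i (u i - r * v ord0))
  * (Z6v al be u vl * Vdm u * Vdm vl)); first by ring.
rewrite E1 E2 IHv -E3 /kappa; ring.
Qed.

(** Both sides change sign under adjacent transpositions of [v], which bring the index [j] to the
    first column. *)
Lemma poly_root v (j : 'I_n.+1) : generic u v ->
  (Lpoly v).[r * v j] = (Rpoly v).[r * v j].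
Proof.
move: {2}(nat_of_ord j) (erefl (nat_of_ord j)) => k.
elim: k v j => [|k IHk] v j jk [gu gv guv].
  have -> : j = ord0 by apply: val_inj.
  apply: poly_root0; split=> // i i' e.
  exact: lift_inj (gv _ _ e).
have lt_kn : (k < n.+1)%N by rewrite ltnW // -jk.
pose j0 := Ordinal lt_kn; have j0j : j = j0.+1 :> nat by [].
pose v' i := v (tperm j0 j i).
have /(IHk v' j0 erefl) : generic u v'.
  by split=> // [i i' /gv/perm_inj //|i i']; apply: guv.
rewrite {2 4}/v' tpermL Lpoly_tperm // Rpoly_tperm ?neq_j01 //.
exact: oppr_inj.
Qed.

Lemma LpolyE v : generic u v -> Lpoly v = Rpoly v.
Proof.
move=> g; have [gu gv guv] := g; apply/eqP; rewrite -subr_eq0; apply/eqP.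
pose rs := [seq r * v j | j <- enum 'I_n.+1] ++ [seq u i | i <- enum 'I_n].
apply: (@roots_geq_poly_eq0 _ _ rs).
- rewrite all_cat; apply/andP; split; apply/allP => x /mapP[j _ ->].
    by rewrite rootE hornerD hornerN poly_root // subrr.
  (* At [u j] the left side has a zero factor, and two rows of [Nmx (vcons (u j) u) v] coincide. *)
  rewrite rootE hornerD hornerN horner_Lpoly horner_Rpoly.
  rewrite det_topmx => [|k]; last exact: s3_neq0.
  rewrite (bigD1 j) //= subrr !(mul0r, mulr0) sub0r oppr_eq0.
  rewrite (@determinant_alternate _ _ _ ord0 (lift ord0 j)) ?mulr0 //.
  by move=> k; rewrite !mxE vcons0 vconsl.
- rewrite cat_uniq; apply/and3P; split.
  + rewrite map_inj_uniq ?enum_uniq // => j j' /(mulfI r_neq0) e.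
    by apply: gv; rewrite e.
  + apply/hasPn => x /mapP[i _ ->]; apply/mapP => -[j _ uE].
    by have := s3_neq0 (guv i j); rewrite uE s3_root eqxx.
  by rewrite map_inj_uniq ?enum_uniq // => i i' e; apply: gu; rewrite e.
rewrite /rs size_cat !size_map -!enumT !size_enum_ord.
rewrite (leq_trans (size_polyD _ _)) // size_polyN geq_max.
by rewrite size_Lpoly size_Rpoly.
Qed.

End Step.

Lemma Z6v0 (u v : 'I_0 -> K) : Z6v al be u v = 1.
Proof.
rewrite /Z6v (big_pred1 (const_mx true)) ?big_ord0 // => X.
have -> : valid X by apply/validP; split; case.
by apply/esym/eqP/matrixP; case.
Qed.

Theorem izergin_korepin n (u v : 'I_n -> K) : generic u v ->
  Z6v al be u v * Vdm u * Vdm v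
  = kappa n * \prod_j v j * \prod_i \prod_j s3 (u i) (v j) * \det (Nmx u v).
Proof.
elim: n u v => [|n IH] u v g.
  by rewrite Z6v0 /Vdm !det_mx00 !big_ord0 /kappa bin0n expr0 !mulr1.
pose ul i := u (lift ord0 i); have [gu gv guv] := g.
have gl : generic ul v.
  by split=> // [i i' /gu/lift_inj //|i j]; apply: guv.
have uE : u =1 vcons (u ord0) ul.
  by move=> i; rewrite /vcons; case: unliftP => [j|] ->.
have IHl v' : generic ul v' -> _ := IH ul v'.
have := congr1 (fun p => p.[u ord0]) (LpolyE IHl gl).
rewrite horner_Lpoly horner_Rpoly det_topmx; last first.
  by move=> j; apply: s3_neq0.
rewrite -(@eq_Z6v _ _ _ _ u _ v _ uE (frefl v)) => E.
rewrite (Vdm_recl u) -/ul -!mulrA; rewrite -!mulrA in E.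
rewrite E /coef [in RHS](big_ord_recl n (fun i => \prod_j s3 (u i) (v j))).
rewrite -!mulrA; congr (_ * (_ * _)).
rewrite [RHS]mulrCA; congr (_ * (_ * \det _)).
by apply/matrixP => i j; rewrite !mxE -uE.
Qed.

End IzerginKorepin.

(** * Symmetry in all spectral parameters *)

Definition vcat (T : Type) m n (u : 'I_m -> T) (v : 'I_n -> T) : 'I_(m + n) -> T :=
  fun i => match split i with inl j => u j | inr k => v k end.

Lemma vcatl T m n (u : 'I_m -> T) (v : 'I_n -> T) i : vcat u v (lshift n i) = u i.
Proof. by rewrite /vcat (unsplitK (inl _ i)). Qed.

Lemma vcatr T m n (u : 'I_m -> T) (v : 'I_n -> T) i : vcat u v (rshift m i) = v i.
Proof. by rewrite /vcat (unsplitK (inr _ i)). Qed.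

(** The sign of the reversal of [n] elements; it relates the product of all differences over ordered
    pairs to the square of the Vandermonde determinant. *)
Definition eps (R : pzRingType) n : R := \prod_(i < n) (-1) ^+ i.

Lemma eps_sqr (R : comNzRingType) n : eps R n * eps R n = 1.
Proof.
rewrite /eps -big_split big1 // => i _ /=.
by rewrite -expr2 sqrr_sign.
Qed.

Lemma prod_diff (R : comNzRingType) n (x : 'I_n -> R) :
  \prod_j \prod_(k | k != j) (x j - x k) = eps R n * Vdm x ^+ 2.
Proof.
elim: n x => [|n IH] x; first by rewrite /Vdm det_mx00 /eps !big_ord0 mul1r expr1n.
rewrite big_ord_recl Vdm_recl /eps big_ord_recr /= -/(eps R n).
rewrite big_mkcond big_ord_recl eqxx /= mul1r.
rewrite [X in _ * X = _](eq_bigr (fun j : 'I_n =>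
  (x (lift ord0 j) - x ord0)
  * \prod_(k | k != j) (x (lift ord0 j) - x (lift ord0 k)))); last first.
  move=> j _; rewrite big_mkcond big_ord_recl /=; congr (_ * _).
  by rewrite -big_mkcond.
rewrite big_split /= IH.
rewrite (eq_bigr (fun i => (-1) * (x (lift ord0 i) - x ord0))) => [|i _].
  rewrite big_split /= prodr_const card_ord.
  ring.
by rewrite mulN1r opprB.
Qed.

Lemma Vdm_vcat (R : comNzRingType) m n (u : 'I_m -> R) (v : 'I_n -> R) :
  Vdm (vcat u v) = Vdm u * Vdm v * \prod_i \prod_k (v i - u k).
Proof.
rewrite /Vdm !det_Vandermonde big_split_ord /=.
rewrite [X in _ * X = _](eq_bigr (fun i : 'I_n => \prod_(j < n | (i < j)%N)
  ((\row_i v i) ord0 j - (\row_i v i) ord0 i))) => [|i _]; last first.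
  rewrite big_mkcond big_split_ord /= big1 ?mul1r => [|j _]; last first.
    by rewrite ltnNge (leq_trans (ltnW (ltn_ord j))) // leq_addr.
  rewrite -big_mkcond /=; apply: eq_big => [j|j _]; first by rewrite ltn_add2l.
  by rewrite !mxE !vcatr.
rewrite (eq_bigr (fun i : 'I_m => \prod_(j < m | (i < j)%N)
  ((\row_i u i) ord0 j - (\row_i u i) ord0 i) * \prod_j (v j - u i))).
  by rewrite big_split /= mulrAC [X in _ = _ * X]exchange_big.
move=> i _; rewrite big_mkcond big_split_ord /= -big_mkcond /=; congr (_ * _).
  by apply: eq_bigr => j _; rewrite !mxE !vcatl.
apply: eq_bigr => j _; rewrite ifT ?mxE ?vcatr ?vcatl //.
by rewrite (leq_trans (ltn_ord i)) // leq_addr.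
Qed.

Section BlockDeterminant.
Variable K : fieldType.

(* With the columns 1, w^3, w^6, ..., w, w^4, w^7, ..., the quotient of this
   determinant by the Vandermonde determinant of w is, up to sign, the Schur
   function indexed by (n-1, n-1, ..., 1, 1, 0, 0). *)
Definition Dmx n (w : 'I_(n + n) -> K) : 'M[K]_(n + n) :=
  \matrix_(i, k) match split k with
                 | inl j => (w i ^+ 3) ^+ j
                 | inr j => w i * (w i ^+ 3) ^+ j
                 end.

Lemma det_Dmx_perm n (w : 'I_(n + n) -> K) (s : 'S_(n + n)) :
  \det (Dmx (fun i => w (s i))) = (-1) ^+ s * \det (Dmx w).
Proof.
have -> : Dmx (fun i => w (s i)) = row_perm s (Dmx w).
  by apply/matrixP => i j; rewrite !mxE.
by rewrite row_permE det_mulmx det_perm.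
Qed.

(** Lagrange interpolation: this matrix sends the values at [x] of a polynomial of degree less than
    [n] to its values at [y]. *)
Definition lag n (x y : 'I_n -> K) : 'M[K]_n :=
  \matrix_(i, j) \prod_(k | k != j) ((y i - x k) / (x j - x k)).

Lemma lagrange_mx n (x y : 'I_n -> K) : injective x ->
  lag x y *m (Vandermonde n (\row_i x i))^T = (Vandermonde n (\row_i y i))^T.
Proof.
move=> x_inj; apply/matrixP => i k; rewrite !mxE.
pose L j : {poly K} := \prod_(l | l != j) ((x j - x l)^-1 *: ('X - (x l)%:P)).
pose p : {poly K} := \sum_j x j ^+ k *: L j - 'X^k.
have Lx j z : (L j).[z] = \prod_(l | l != j) ((z - x l) / (x j - x l)).
  rewrite horner_prod; apply: eq_bigr => l _.
  by rewrite hornerZ !hornerE mulrC.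
have p0 : p = 0.
  apply: (@roots_geq_poly_eq0 _ _ [seq x j | j <- enum 'I_n]).
  - apply/allP => z /mapP[j _ ->]; rewrite rootE hornerD hornerN hornerXn horner_sum.
    rewrite (bigD1 j) //= hornerZ Lx big1 => [|l lj]; last first.
      by rewrite divff // subr_eq0 (inj_eq x_inj) eq_sym.
    rewrite mulr1 big1 ?addr0 ?subrr // => l lj.
    by rewrite hornerZ Lx (bigD1 j) 1?eq_sym //= subrr !mul0r mulr0.
  - by rewrite map_inj_uniq ?enum_uniq.
  rewrite size_map size_enum_ord (leq_trans (size_polyD _ _)) // geq_max.
  rewrite size_polyN size_polyXn ltn_ord andbT.
  apply: (leq_trans (size_sum _ _ _)); apply/bigmax_leqP => j _.
  apply: (leq_trans (size_scale_leq _ _)).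
  rewrite /L big_mkcond.
  have n0 : (0 < n)%N := leq_ltn_trans (leq0n _) (ltn_ord j).
  apply: leq_trans (size_prod_le (d := fun l => (l != j)) _) _.
    move=> l; case: (l != j); rewrite ?size_poly1 //.
    by rewrite (leq_trans (size_scale_leq _ _)) // size_XsubC.
  rewrite (bigD1 j) //= eqxx add0n (eq_bigr (fun=> 1%N)) => [|l ->//].
  by rewrite sum_nat_const cardC1 card_ord muln1 prednK.
have := congr1 (fun p => p.[y i]) p0; rewrite /p hornerD hornerN hornerXn horner_sum horner0.
move/eqP; rewrite subr_eq0 => /eqP <-; apply: eq_bigr => j _.
by rewrite !mxE hornerZ Lx mulrC.
Qed.

(** Interpolation in the cubes makes the lower blocks [C *m A] and [V *m (C *m A)]. Eliminating the
    first leaves [(V *m C - C *m U) *m A], where the entry of the first factor is [v i - u j] times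
    that of [C]. As [y i - x j = (v i - u j) * s3 (u j) (v i)], that factor is the transpose of
    [Nmx u v] between two diagonal matrices. *)
Lemma det_Dmx n (u v : 'I_n -> K) : generic u v ->
  \det (Dmx (vcat u v))
  = eps K n * (\prod_i \prod_k (v i ^+ 3 - u k ^+ 3)) * \det (Nmx u v).
Proof.
move=> [gu gv guv]; pose x i := u i ^+ 3; pose y i := v i ^+ 3.
pose A := (Vandermonde n (\row_i x i))^T; pose C := lag x y.
pose U := diag_mx (\row_i u i); pose V := diag_mx (\row_i v i).
have -> : Dmx (vcat u v) = block_mx A (U *m A) (C *m A) (V *m (C *m A)).
  rewrite lagrange_mx //; apply/matrixP => i k; rewrite mxE.
  case: (split_ordP i) => j ->; case: (split_ordP k) => l ->;
    rewrite ?block_mxEul ?block_mxEur ?block_mxEdl ?block_mxEdr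
      ?(unsplitK (inl _ l)) ?(unsplitK (inr _ l)) ?vcatl ?vcatr;
    by rewrite ?mul_diag_mx !mxE.
pose W := block_mx 1%:M 0 (- C) 1%:M : 'M[K]_(n + n).
have W1 : \det W = 1 by rewrite det_lblock !det1 mulr1.
rewrite -[LHS]mul1r -{1}W1 -det_mulmx mulmx_block !mul1mx !mul0mx !addr0.
rewrite mulNmx addNr mulNmx [C *m (U *m A)]mulmxA [V *m (C *m A)]mulmxA.
rewrite -mulNmx -mulmxDl det_ublock det_mulmx.
have dA : \det A = Vdm x by rewrite det_tr.
pose P i := \prod_k (y i - x k).
pose Q j := \prod_(k | k != j) (x j - x k)^-1.
have -> : - (C *m U) + V *m C
    = diag_mx (\row_i P i) *m (Nmx u v)^T *m diag_mx (\row_j Q j).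
  apply/matrixP => i j.
  rewrite /U /V !mul_mx_diag !mul_diag_mx !mxE big_split /= -/(Q j).
  rewrite /P [in RHS](bigD1 j) //=.
  have -> : y i - x j = (v i - u j) * s3 (u j) (v i) by rewrite /y /x /s3; ring.
  by field; apply: s3_neq0.
rewrite !det_mulmx !det_diag dA det_tr.
under [\prod_i (\row_i P i) ord0 i]eq_bigr => i _ do rewrite mxE.
under [\prod_i (\row_j Q j) ord0 i]eq_bigr => i _ do rewrite mxE.
have QE : \prod_j Q j = (eps K n * Vdm x ^+ 2)^-1.
  rewrite -prod_diff -prodfV; apply: eq_bigr => j _; exact: prodfV.
have x0 : Vdm x != 0.
  rewrite /Vdm det_Vandermonde; apply/prodf_neq0 => i _.
  apply/prodf_neq0 => j ij; rewrite !mxE subr_eq0 (inj_eq gu).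
  by rewrite -val_eqE neq_ltn ij orbT.
have e0 : eps K n != 0.
  by apply: contra_eq_neq (eps_sqr K n) => ->; rewrite mul0r eq_sym oner_neq0.
have ei : (eps K n)^-1 = eps K n by apply: (mulfI e0); rewrite mulfV // eps_sqr.
have -> : \prod_i P i = \prod_i \prod_k (v i ^+ 3 - u k ^+ 3) by [].
by rewrite QE invfM ei; field.
Qed.

End BlockDeterminant.

Section Symmetry.
Variables (K : fieldType) (q : K).
Hypotheses (hq : q ^+ 2 = q - 1) (hchar : [pchar K] =i pred0).
Local Notation al := (alpha q).
Local Notation be := (beta q).

Lemma generic_vcat n (u v : 'I_n -> K) :
  generic u v <-> injective (fun i => vcat u v i ^+ 3).
Proof.
split=> [[gu gv guv] i j|g].
  case: (split_ordP i) => i' ->; case: (split_ordP j) => j' ->;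
    rewrite ?vcatl ?vcatr.
  - by move/gu ->.
  - by move/eqP; rewrite (negbTE (guv _ _)).
  - by move/esym/eqP; rewrite (negbTE (guv _ _)).
  - by move/gv ->.
split=> [i j uij|i j vij|i j].
- by apply: (@lshift_inj n n); apply: g; rewrite !vcatl.
- by apply: (@rshift_inj n n); apply: g; rewrite !vcatr.
apply/eqP => uv; have /g/eqP : vcat u v (lshift n i) ^+ 3 = vcat u v (rshift n j) ^+ 3.
  by rewrite vcatl vcatr.
by rewrite eq_lrshift.
Qed.

(** The factors [v i - u k] of the Vandermonde determinant of [vcat u v] and the [s3] of the
    determinant formula multiply to differences of cubes, which [det_Dmx] absorbs. The asymmetry
    between [u] and [v] is then confined to [\prod_j v j]. *)
Lemma Z6v_Dmx n (u v : 'I_n -> K) : generic u v ->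
  Z6v al be u v * Vdm (vcat u v)
  = kappa K n * eps K n * \prod_j v j * \det (Dmx (vcat u v)).
Proof.
move=> g; rewrite Vdm_vcat !mulrA izergin_korepin // det_Dmx //.
have -> : \prod_i \prod_k (v i ^+ 3 - u k ^+ 3)
  = (\prod_i \prod_k (v i - u k)) * \prod_i \prod_j s3 (u i) (v j).
  rewrite [X in _ * X]exchange_big -big_split; apply: eq_bigr => i _.
  by rewrite -big_split; apply: eq_bigr => j _; rewrite /s3 /=; ring.
rewrite -[kappa K n in LHS]mulr1 -(eps_sqr K n); ring.
Qed.

Lemma Z6v_sym_generic n (u v u' v' : 'I_n -> K) (s : 'S_(n + n)) :
  generic u v -> vcat u' v' =1 (fun i => vcat u v (s i)) ->
  Z6v al be u' v' * \prod_j v j = Z6v al be u v * \prod_j v' j.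
Proof.
move=> g w'E; have /generic_vcat g3 := g.
have g' : generic u' v'.
  by apply/generic_vcat => i j; rewrite !w'E => /g3/perm_inj.
have V0 : Vdm (vcat u v) != 0.
  rewrite /Vdm det_Vandermonde; apply/prodf_neq0 => i _.
  apply/prodf_neq0 => j ij; rewrite !mxE subr_eq0.
  apply: contraTneq ij => e.
  by rewrite (g3 j i) ?ltnn //= e.
have VE : Vdm (vcat u' v') = (-1) ^+ s * Vdm (vcat u v).
  rewrite -Vdm_perm /Vdm; congr (\det (Vandermonde _ _)).
  by apply/matrixP => i j; rewrite !mxE w'E.
have DE : \det (Dmx (vcat u' v')) = (-1) ^+ s * \det (Dmx (vcat u v)).
  rewrite -det_Dmx_perm; congr determinant.
  by apply/matrixP => i j; rewrite !mxE w'E.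
have E := Z6v_Dmx g.
have E' : Z6v al be u' v' * Vdm (vcat u v)
    = kappa K n * eps K n * \prod_j v' j * \det (Dmx (vcat u v)).
  apply: (mulfI (negbT (signr_eq0 K s))); rewrite mulrCA -VE Z6v_Dmx // DE.
  by rewrite mulrCA.
apply: (mulIf V0); rewrite mulrAC E' [RHS]mulrAC E; ring.
Qed.

End Symmetry.

(** * Condensation *)

Lemma det_schur (F : fieldType) k m (M : 'M[F]_(k + m)) :
  drsubmx M \in unitmx ->
  \det M = \det (drsubmx M)
           * \det (ulsubmx M - ursubmx M *m invmx (drsubmx M) *m dlsubmx M).
Proof.
move=> uE; rewrite -{1}[M]submxK; set A := ulsubmx M; set B := ursubmx M.
set C := dlsubmx M; set E := drsubmx M in uE *.
have -> : block_mx A B C E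
    = block_mx 1%:M (B *m invmx E) 0 1%:M *m block_mx (A - B *m invmx E *m C) 0 C E.
  by rewrite mulmx_block !mul1mx !mul0mx !add0r subrK mulmxKV.
by rewrite det_mulmx det_ublock det_lblock !det1 !mul1r mulrC.
Qed.

Lemma det2 (R : comNzRingType) (M : 'M[R]_2) :
  \det M = M ord0 ord0 * M ord_max ord_max - M ord0 ord_max * M ord_max ord0.
Proof.
rewrite (expand_det_row _ ord0) !big_ord_recl big_ord0 /cofactor !det_mx11 !mxE.
rewrite /= !expr0 !expr1 !mul1r addr0 mulN1r mulrN.
by congr (_ * M _ _ - M _ _ * M _ _); apply: val_inj.
Qed.

Section Condensation.
Variables (K : fieldType) (q : K).
Hypotheses (hq : q ^+ 2 = q - 1) (hchar : [pchar K] =i pred0).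
Local Notation al := (alpha q).
Local Notation be := (beta q).
Variables (m : nat) (p p' : 'I_m -> K).
Let E := Nmx p p'.

Lemma vcons_lshift T n (x : T) (u : 'I_n -> T) (i : 'I_1) :
  vcons x u (lshift n i) = x.
Proof. by rewrite -[RHS](vcons0 x u); congr vcons; apply: val_inj; case: i => -[]. Qed.

Lemma vcons_rshift T n (x : T) (u : 'I_n -> T) j : vcons x u (rshift 1 j) = u j.
Proof. by rewrite -[RHS](vconsl x u); congr vcons; apply: val_inj. Qed.

Lemma vcons2_rshift T n (x y : T) (u : 'I_n -> T) j :
  vcons x (vcons y u) (rshift 2 j) = u j.
Proof. by rewrite -[RHS](vconsl y u) -[RHS](vconsl x); congr vcons; apply: val_inj. Qed.

Lemma vcons2_lshift0 T n (x y : T) (u : 'I_n -> T) :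
  vcons x (vcons y u) (lshift n (ord0 : 'I_2)) = x.
Proof. by rewrite -[RHS](vcons0 x (vcons y u)); congr vcons; apply: val_inj. Qed.

Lemma vcons2_lshift1 T n (x y : T) (u : 'I_n -> T) :
  vcons x (vcons y u) (lshift n (ord_max : 'I_2)) = y.
Proof.
rewrite -[RHS](vcons0 y u) -[RHS](vconsl x).
by congr vcons; apply: val_inj.
Qed.

(* The Schur complement of E in the matrix bordered by x and y. *)
Let sig x y := (s3 x y)^-1
  - \sum_l (\sum_k (s3 x (p' k))^-1 * invmx E k l) * (s3 (p l) y)^-1.

Lemma det_border1 x y : E \in unitmx ->
  \det (Nmx (vcons x p) (vcons y p')) = \det E * sig x y.
Proof.
move=> uE; pose M : 'M[K]_(1 + m) := Nmx (vcons x p) (vcons y p').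
have EM : drsubmx M = E.
  by apply/matrixP => i j; rewrite !mxE !vcons_rshift.
rewrite -/M (det_schur (M := M)) EM // det_mx11; congr (_ * _).
rewrite !mxE !vcons_lshift; congr (_ - _); apply: eq_bigr => l _.
rewrite !mxE vcons_lshift vcons_rshift; congr (_ * _); apply: eq_bigr => k _.
by rewrite !mxE vcons_lshift vcons_rshift.
Qed.

(** A form of the Desnanot-Jacobi identity: by [det_border1] each [sig] is a singly bordered
    determinant divided by [\det E]. *)
Lemma det_border2 a c b d : E \in unitmx ->
  \det (Nmx (vcons a (vcons c p)) (vcons b (vcons d p')))
  = \det E * (sig a b * sig c d - sig a d * sig c b).
Proof.
move=> uE; pose M : 'M[K]_(2 + m) :=
  Nmx (vcons a (vcons c p)) (vcons b (vcons d p')).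
have EM : drsubmx M = E.
  by apply/matrixP => i j; rewrite !mxE !vcons2_rshift.
rewrite -/M (det_schur (M := M)) EM // det2; congr (_ * _).
set S := (ulsubmx M - _).
have SE i j : S i j = sig (vcons a (vcons c p) (lshift m i))
                          (vcons b (vcons d p') (lshift m j)).
  rewrite !mxE; congr (_ - _); apply: eq_bigr => l _.
  rewrite !mxE vcons2_rshift; congr (_ * _); apply: eq_bigr => k _.
  by rewrite !mxE vcons2_rshift.
by rewrite !SE !vcons2_lshift0 !vcons2_lshift1.
Qed.

Lemma generic_sub m1 m2 n1 n2 (u : 'I_m1 -> K) (v : 'I_n1 -> K)
    (u' : 'I_m2 -> K) (v' : 'I_n2 -> K) f g :
  generic u v -> injective f -> injective g ->
  u' =1 u \o f -> v' =1 v \o g -> generic u' v'.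
Proof.
move=> [gu gv guv] f_inj g_inj uE vE; split=> [i j|i j|i j]; rewrite ?uE ?vE.
- by move/gu/f_inj.
- by move/gv/g_inj.
exact: guv.
Qed.

Lemma vcons_lift1 T n (x y : T) (u : 'I_n -> T) :
  vcons x u =1 vcons x (vcons y u) \o lift (lift ord0 ord0).
Proof.
move=> i /=; case: (unliftP ord0 i) => [j|] ->.
  rewrite vconsl -[LHS](vconsl y u) -[LHS](vconsl x).
  by congr vcons; apply: val_inj.
by rewrite vcons0 -[LHS](vcons0 x (vcons y u)); congr vcons; apply: val_inj.
Qed.

Lemma vcons_lift0 T n (x y : T) (u : 'I_n -> T) :
  vcons y u =1 vcons x (vcons y u) \o lift ord0.
Proof. by move=> i /=; rewrite vconsl. Qed.

Lemma prod_vcons (T : Type) n (x : T) (u : 'I_n -> T) (f : T -> K) :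
  \prod_i f (vcons x u i) = f x * \prod_i f (u i).
Proof.
rewrite big_ord_recl vcons0; congr (_ * _).
by apply: eq_bigr => i _; rewrite vconsl.
Qed.

Lemma Vdm_vcons n x (u : 'I_n -> K) :
  Vdm (vcons x u) = (\prod_i (u i - x)) * Vdm u.
Proof.
rewrite Vdm_recl vcons0; congr (_ * _).
  by apply: eq_bigr => i _; rewrite vconsl.
by rewrite /Vdm; congr (\det (Vandermonde _ _)); apply/rowP => i;
  rewrite !mxE vconsl.
Qed.

Lemma prod_vcons2 m1 n1 x y (u : 'I_m1 -> K) (v : 'I_n1 -> K) :
  \prod_i \prod_j s3 (vcons x u i) (vcons y v j)
  = s3 x y * \prod_j s3 x (v j)
    * ((\prod_i s3 (u i) y) * \prod_i \prod_j s3 (u i) (v j)).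
Proof.
rewrite (prod_vcons _ _ (fun z => \prod_j s3 z (vcons y v j))).
rewrite (prod_vcons _ _ (s3 x)); congr (_ * _).
rewrite -big_split; apply: eq_bigr => i _ /=.
exact: (prod_vcons y v (s3 (u i))).
Qed.

Lemma kappaS n : kappa K n.+1 = kappa K n * 3^-1 ^+ n.
Proof. by rewrite /kappa binS bin1 exprD. Qed.

Lemma Vdm_neq0 n (u : 'I_n -> K) : injective (fun i => u i ^+ 3) -> Vdm u != 0.
Proof.
move=> gu; rewrite /Vdm det_Vandermonde; apply/prodf_neq0 => i _.
apply/prodf_neq0 => j ij; rewrite !mxE subr_eq0; apply: contraTneq ij => e.
by rewrite (gu j i) ?ltnn //= e.
Qed.

(** The nonvanishing partition function makes [E] invertible, so [det_border2] applies. The factor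
    [(c - a) * (d - b)] comes from the Vandermonde determinants, the [s3] in front of each product
    restore the two that it lacks, and the 3 is the quotient of [kappa K m.+1 ^+ 2] by
    [kappa K m * kappa K m.+2]. *)
Theorem condensation a c b d :
  generic (vcons a (vcons c p)) (vcons b (vcons d p')) ->
  Z6v al be p p' != 0 ->
  3 * Z6v al be (vcons a (vcons c p)) (vcons b (vcons d p')) * Z6v al be p p'
    * ((c - a) * (d - b))
  = s3 a d * s3 c b * Z6v al be (vcons a p) (vcons b p')
      * Z6v al be (vcons c p) (vcons d p')
    - s3 a b * s3 c d * Z6v al be (vcons a p) (vcons d p')
      * Z6v al be (vcons c p) (vcons b p').
Proof.
move=> g Z0.
have l0 n : injective (lift (ord0 : 'I_n.+1)) by apply: lift_inj.
have l1 n : injective (lift (lift ord0 ord0 : 'I_n.+2)) by apply: lift_inj.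
have gab : generic (vcons a p) (vcons b p').
  by apply: generic_sub g (@l1 _) (@l1 _) _ _; apply: vcons_lift1.
have gad : generic (vcons a p) (vcons d p').
  by apply: generic_sub g (@l1 _) (@l0 _) _ _; [apply: vcons_lift1|apply: vcons_lift0].
have gcb : generic (vcons c p) (vcons b p').
  by apply: generic_sub g (@l0 _) (@l1 _) _ _; [apply: vcons_lift0|apply: vcons_lift1].
have gcd : generic (vcons c p) (vcons d p').
  by apply: generic_sub g (@l0 _) (@l0 _) _ _; apply: vcons_lift0.
have gp : generic p p'.
  by apply: generic_sub gcd (@l0 _) (@l0 _) _ _ => i /=; rewrite vconsl.
have h3 := char3 hchar.
have I0 := izergin_korepin hq hchar gp; rewrite -/E in I0.
have [gu gv _] := gp; have V0 := Vdm_neq0 gu; have V0' := Vdm_neq0 gv.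
have uE : E \in unitmx.
  rewrite unitmxE unitfE; apply: contra_neq Z0 => E0.
  by apply: (mulIf V0); apply: (mulIf V0'); rewrite I0 E0 mulr0 !mul0r.
have Iab := izergin_korepin hq hchar gab.
have Iad := izergin_korepin hq hchar gad.
have Icb := izergin_korepin hq hchar gcb.
have Icd := izergin_korepin hq hchar gcd.
have I4 := izergin_korepin hq hchar g.
rewrite !prod_vcons2 !(prod_vcons _ _ id) !Vdm_vcons !kappaS ?det_border1 //
  in Iab Iad Icb Icd.
rewrite !prod_vcons2 !(prod_vcons _ _ id) !Vdm_vcons !kappaS det_border2 // in I4.
rewrite !(prod_vcons _ _ (s3 _)) (prod_vcons _ _ (fun z => s3 z b)) in I4.
rewrite (prod_vcons _ _ (fun z => z - a)) (prod_vcons _ _ (fun z => z - b)) in I4.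
rewrite [3^-1 ^+ m.+1]exprSr in I4.
have nz x y : generic (vcons x p) (vcons y p') ->
    \prod_i (p i - x) != 0 /\ \prod_i (p' i - y) != 0.
  move=> [/Vdm_neq0 + /Vdm_neq0]; rewrite !Vdm_vcons !mulf_eq0 !negb_or.
  by move=> /andP[-> _] /andP[-> _].
have [na nb] := nz _ _ gab; have [nc nd] := nz _ _ gcd.
move: (\prod_i (p i - a)) (\prod_i (p i - c)) (\prod_i (p' i - b))
  (\prod_i (p' i - d)) na nb nc nd I0 I4 Iab Iad Icb Icd => ga gc gb gd na nb nc nd.
move: V0 V0' (Z6v al be (vcons a (vcons c p)) (vcons b (vcons d p')))
  (Z6v al be p p') (Z6v al be (vcons a p) (vcons b p'))
  (Z6v al be (vcons c p) (vcons d p')) (Z6v al be (vcons a p) (vcons d p'))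
  (Z6v al be (vcons c p) (vcons b p')) => V0 V0' z4 z0 zab zcd zad zcb.
move: (sig a b) (sig c d) (sig a d) (sig c b) (\prod_i \prod_j s3 (p i) (p' j))
  (\det E) (s3 a b) (s3 c d) (s3 a d) (s3 c b) (kappa K m) (3^-1 ^+ m)
  (\prod_j s3 a (p' j)) (\prod_j s3 c (p' j)) (\prod_i s3 (p i) b)
  (\prod_i s3 (p i) d) (\prod_i p' i) => xab xcd xad xcb S0 e.
move=> sab scd sad scb k t sA sC tB tD pi I0 I4 Iab Iad Icb Icd.
have D0 : ga * gc * gb * gd * (Vdm p * Vdm p') ^+ 2 != 0.
  by rewrite !mulf_neq0 ?expf_neq0 ?mulf_neq0.
apply: (mulIf D0).
transitivity (3 * (z4 * ((c - a) * ga * (gc * Vdm p))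
  * ((d - b) * gb * (gd * Vdm p'))) * (z0 * Vdm p * Vdm p')); first by ring.
rewrite I4 I0.
transitivity (sad * scb * (zab * (ga * Vdm p) * (gb * Vdm p'))
    * (zcd * (gc * Vdm p) * (gd * Vdm p'))
  - sab * scd * (zad * (ga * Vdm p) * (gd * Vdm p'))
    * (zcb * (gc * Vdm p) * (gb * Vdm p'))); last by ring.
by rewrite Iab Icd Iad Icb; field.
Qed.

End Condensation.

(** * Specialization of the generic identities *)

Section Specialization.
Variables (K : fieldType) (q : K).
Hypotheses (hq : q ^+ 2 = q - 1) (hchar : [pchar K] =i pred0).
Local Notation al := (alpha q).
Local Notation be := (beta q).
Let F : fieldType := {fraction {poly K}}.
Local Notation "x %:F" := (@tofrac {poly K} x).
Let iota : {rmorphism K -> F} := @tofrac {poly K} \o polyC.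

Let qF : F := iota q.

Lemma hqF : qF ^+ 2 = qF - 1.
Proof. by rewrite -rmorphXn hq rmorphB rmorph1. Qed.

Lemma hcharF : [pchar F] =i pred0.
Proof. by move=> k; rewrite (fmorph_pchar iota) hchar. Qed.

Lemma alF : alpha qF = (al%:P)%:F.
Proof. by rewrite /alpha -[RHS]/(iota _) fmorph_div rmorphD rmorph1 rmorph_nat. Qed.

Lemma beF : beta qF = (be%:P)%:F.
Proof. by rewrite /beta -[RHS]/(iota _) fmorph_div rmorphB !rmorph_nat. Qed.

Lemma natr_inj : injective (fun n => n%:R : K).
Proof.
move=> m n; wlog le_mn : m n / (m <= n)%N => [wl|/eqP].
  by case/orP: (leq_total m n) => /wl // + /esym => /[apply].
rewrite eq_sym -subr_eq0 -natrB // (pcharf0P K).1 // subn_eq0 => le_nm.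
by apply/eqP; rewrite eqn_leq le_mn.
Qed.

(* Perturbing the k-th parameter by k.+1 times an indeterminate makes all the
   cubes distinct; identities are then transported back by setting it to 0. *)
Definition pert (a : K) (k : nat) : {poly K} := a%:P + (k.+1%:R)%:P * 'X.

(** The coefficient of degree 3 of the cube is the cube of [k.+1], whatever [a] is, and it
    determines [k] in characteristic 0. *)
Lemma pert_cube_inj a b k l : pert a k ^+ 3 = pert b l ^+ 3 -> k = l.
Proof.
have E c d : (pert c d ^+ 3)`_3 = d.+1%:R ^+ 3.
  have -> : pert c d ^+ 3 = (d.+1%:R)%:P ^+ 3 * 'X^3
      + (((3%:R)%:P * c%:P * (d.+1%:R)%:P ^+ 2) * 'X^2
      + (((3%:R)%:P * c%:P ^+ 2 * (d.+1%:R)%:P) * 'X + c%:P ^+ 3)).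
    by rewrite /pert; move: (d.+1%:R : K) => e; rewrite polyC_natr; ring.
  rewrite -!polyC_exp -!polyCM !coefD !coefCM !coefXn coefX coefC /=.
  by rewrite !mulr0 !addr0 mulr1.
move/(congr1 (fun p : {poly K} => p`_3)); rewrite !E -!natrX.
by move/natr_inj/eqP; rewrite eqn_exp2r // => /eqP[].
Qed.

Lemma generic_pert m n (u : 'I_m -> K) (v : 'I_n -> K) :
  generic (fun i => (pert (u i) i)%:F : F) (fun j => (pert (v j) (m + j))%:F).
Proof.
split=> [i j|i j|i j]; rewrite -!rmorphXn.
- by move/eqP; rewrite tofrac_eq => /eqP/pert_cube_inj/val_inj.
- by move/eqP; rewrite tofrac_eq => /eqP/pert_cube_inj/addnI/val_inj.
rewrite tofrac_eq; apply: contraTneq (ltn_ord i) => /pert_cube_inj->.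
by rewrite -leqNgt leq_addr.
Qed.

Lemma Z6v_tofrac n (u v : 'I_n -> {poly K}) :
  Z6v (alpha qF) (beta qF) (fun i => (u i)%:F) (fun j => (v j)%:F)
  = (Z6v al%:P be%:P u v)%:F.
Proof. by rewrite [RHS]rmorph_Z6v alF beF. Qed.

Lemma Z6v_horner0 n (u v : 'I_n -> {poly K}) :
  (Z6v al%:P be%:P u v).[0]
  = Z6v al be (fun i => (u i).[0]) (fun j => (v j).[0]).
Proof. by rewrite -[LHS]/(horner_eval 0 _) rmorph_Z6v /= !horner_evalE !hornerC. Qed.

Lemma pert0 a k : (pert a k).[0] = a.
Proof. by rewrite /pert !hornerE. Qed.

Theorem Z6v_sym n (u v u' v' : 'I_n -> K) (s : 'S_(n + n)) :
  vcat u' v' =1 (fun i => vcat u v (s i)) ->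
  Z6v al be u' v' * \prod_j v j = Z6v al be u v * \prod_j v' j.
Proof.
move=> w'E.
pose U i := pert (u i) i; pose V j := pert (v j) (n + j).
(* The target is perturbed by permuting the perturbed source, not afresh, so that both remain
   permutations of each other. *)
pose W' i := vcat U V (s i).
pose U' i := W' (lshift n i); pose V' j := W' (rshift n j).
have E : (Z6v al%:P be%:P U' V' * \prod_j V j)%:F
       = (Z6v al%:P be%:P U V * \prod_j V' j)%:F :> F.
  rewrite [LHS]rmorphM [RHS]rmorphM !rmorph_prod /= -!Z6v_tofrac.
  apply: (Z6v_sym_generic hqF hcharF (s := s)); first exact: generic_pert.
  move=> i; transitivity (W' i)%:F.
    by case: (split_ordP i) => j ->; rewrite ?vcatl ?vcatr.
  rewrite /W'; case: (split_ordP (s i)) => j ->; by rewrite ?vcatl ?vcatr.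
have W0 i : (vcat U V i).[0] = vcat u v i.
  by case: (split_ordP i) => j ->; rewrite ?vcatl ?vcatr pert0.
move/eqP: E; rewrite tofrac_eq => /eqP/(congr1 (fun p => p.[0])).
rewrite !hornerM !horner_prod !Z6v_horner0.
have uE i : (U' i).[0] = u' i by rewrite W0 -w'E vcatl.
have vE i : (V' i).[0] = v' i by rewrite W0 -w'E vcatr.
rewrite (eq_Z6v _ _ uE vE).
rewrite (eq_Z6v _ _ (fun i => pert0 (u i) i) (fun i => pert0 (v i) (n + i))).
have <- : \prod_i (V' i).[0] = \prod_i v' i by apply: eq_bigr => i _.
by have <- : \prod_i (V i).[0] = \prod_i v i by apply: eq_bigr => i _; apply: pert0.
Qed.

Definition ones n : 'I_n -> K := fun=> 1.
Arguments ones : clear implicits.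

Theorem condensation1 m a b c d :
  Z6v al be (ones m) (ones m) != 0 ->
  3 * Z6v al be (vcons a (vcons c (ones m))) (vcons b (vcons d (ones m)))
    * Z6v al be (ones m) (ones m) * ((c - a) * (d - b))
  = s3 a d * s3 c b * Z6v al be (vcons a (ones m)) (vcons b (ones m))
      * Z6v al be (vcons c (ones m)) (vcons d (ones m))
    - s3 a b * s3 c d * Z6v al be (vcons a (ones m)) (vcons d (ones m))
      * Z6v al be (vcons c (ones m)) (vcons b (ones m)).
Proof.
move=> Z0.
(* The indices are the positions in the concatenation of the two bordered vectors, each of length
   [m.+2], as [generic_pert] requires. *)
pose p (i : 'I_m) := pert 1 i.+2; pose p' (i : 'I_m) := pert 1 (m.+2 + i.+2).
pose A := pert a 0; pose C := pert c 1; pose B := pert b m.+2; pose D := pert d m.+3.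
have g : generic (vcons A%:F (vcons C%:F (fun i => (p i)%:F)))
                 (vcons B%:F (vcons D%:F (fun i => (p' i)%:F))) :> Prop.
  have g0 := generic_pert (vcons a (vcons c (ones m))) (vcons b (vcons d (ones m))).
  apply: (generic_sub g0 (f := id) (g := id)) => // i /=.
    case: (unliftP ord0 i) => [j|] ->; rewrite ?vcons0 ?vconsl //.
    by case: (unliftP ord0 j) => [k|] ->; rewrite ?vcons0 ?vconsl.
  case: (unliftP ord0 i) => [j|] ->; rewrite ?vcons0 ?vconsl ?addn0 //.
  case: (unliftP ord0 j) => [k|] ->; rewrite ?vcons0 ?vconsl //.
  by rewrite /D /= /bump /= addn1.
have p0 i : (p i).[0] = 1 by apply: pert0.
have p0' i : (p' i).[0] = 1 by apply: pert0.
have PZ0 : Z6v al%:P be%:P p p' != 0.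
  apply: contra_neq Z0 => /(congr1 (fun P => P.[0])).
  by rewrite Z6v_horner0 horner0 (eq_Z6v _ _ p0 p0').
have fcons k (x : {poly K}) (u : 'I_k -> {poly K}) :
    vcons x%:F (fun i => (u i)%:F) =1 (fun i => (vcons x u i)%:F : F).
  by move=> i; rewrite /vcons; case: unlift.
have descend (x1 x2 x3 x4 z4 z0 zab zcd zad zcb : {poly K}) :
    3 * z4%:F * z0%:F * ((x3%:F - x1%:F) * (x4%:F - x2%:F))
    = s3 x1%:F x4%:F * s3 x3%:F x2%:F * zab%:F * zcd%:F
      - s3 x1%:F x2%:F * s3 x3%:F x4%:F * zad%:F * zcb%:F :> F ->
    3 * z4 * z0 * ((x3 - x1) * (x4 - x2))
    = s3 x1 x4 * s3 x3 x2 * zab * zcd - s3 x1 x2 * s3 x3 x4 * zad * zcb.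
  have s3F x y : s3 x%:F y%:F = (s3 x y)%:F :> F.
    by rewrite /s3 !tofracD !tofracXn tofracM.
  move=> e; apply/eqP; rewrite -tofrac_eq; apply/eqP.
  by rewrite tofracB !tofracM !tofracB -!s3F -e rmorph_nat.
have tof1 x y : Z6v (alpha qF) (beta qF) (vcons x%:F (fun i => (p i)%:F))
      (vcons y%:F (fun i => (p' i)%:F))
    = (Z6v al%:P be%:P (vcons x p) (vcons y p'))%:F.
  by rewrite (eq_Z6v _ _ (fcons _ _ _) (fcons _ _ _)) Z6v_tofrac.
have fcons2 k (x y : {poly K}) (u : 'I_k -> {poly K}) :
    vcons x%:F (vcons y%:F (fun i => (u i)%:F))
    =1 (fun i => (vcons x (vcons y u) i)%:F : F).
  by move=> i; rewrite /vcons; case: unlift => // j; case: unlift.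
have := condensation hqF hcharF g.
rewrite (Z6v_tofrac p p') tofrac_eq0 !tof1.
rewrite (eq_Z6v _ _ (fcons2 _ _ _ p) (fcons2 _ _ _ p')) Z6v_tofrac.
move=> /(_ PZ0)/descend/(congr1 (fun P => P.[0])).
have c0 k (x : {poly K}) (u : 'I_k -> {poly K}) (y : K) (v : 'I_k -> K) :
    x.[0] = y -> (forall i, (u i).[0] = v i) ->
    forall i, (vcons x u i).[0] = vcons y v i.
  by move=> xy uv i; rewrite /vcons; case: unlift.
have A0 : A.[0] = a := pert0 _ _; have B0 : B.[0] = b := pert0 _ _.
have C0 : C.[0] = c := pert0 _ _; have D0 : D.[0] = d := pert0 _ _.
rewrite !(hornerD, hornerN, hornerM) !Z6v_horner0.
rewrite (eq_Z6v _ _ p0 p0') (eq_Z6v _ _ (c0 _ _ _ _ _ A0 (c0 _ _ _ _ _ C0 p0))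
  (c0 _ _ _ _ _ B0 (c0 _ _ _ _ _ D0 p0'))).
rewrite (eq_Z6v _ _ (c0 _ _ _ _ _ A0 p0) (c0 _ _ _ _ _ B0 p0')).
rewrite (eq_Z6v _ _ (c0 _ _ _ _ _ A0 p0) (c0 _ _ _ _ _ D0 p0')).
rewrite (eq_Z6v _ _ (c0 _ _ _ _ _ C0 p0) (c0 _ _ _ _ _ B0 p0')).
rewrite (eq_Z6v _ _ (c0 _ _ _ _ _ C0 p0) (c0 _ _ _ _ _ D0 p0')).
rewrite !(hornerC, hornerX, mulr0, addr0) /s3 !expr2.
by [].
Qed.

End Specialization.

(** * Corners *)

Section Rotation.
Variables (R : comNzRingType) (n : nat).
Implicit Types z : R.

Lemma quad_rotm z1 z2 z3 z4 (X : 'M[bool]_n.+1) :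
  quad z1 z2 z3 z4 (rotm X) = quad z2 z3 z4 z1 X.
Proof.
rewrite /quad expT_rotm expR_rotm expB_rotm expL_rotm.
by rewrite -!mulrA mulrC !mulrA.
Qed.

(* Sum over the matrices with a nonzero entry in the corner selected by i, j. *)
Definition Qsum (i j : bool) z1 z2 z3 z4 : R :=
  \sum_(X : 'M[bool]_n.+1 | valid X) quad z1 z2 z3 z4 X
    * (X (if i then ord_max else ord0) (if j then ord_max else ord0))%:R.

Lemma Qsum_rotm i j z1 z2 z3 z4 :
  Qsum i j z1 z2 z3 z4 = Qsum (~~ j) i z2 z3 z4 z1.
Proof.
rewrite /Qsum sum_rotm; apply: eq_bigr => X _; rewrite quad_rotm mxE.
by case: j; rewrite ?rev_ord0 ?rev_ord_max.
Qed.

End Rotation.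

Section CornerSums.
Variables (R : comNzRingType) (n : nat).
Implicit Types z : R.

Lemma ord_maxS : ord_max = lift ord0 (ord_max : 'I_n.+1) :> 'I_n.+2.
Proof. exact: val_inj. Qed.

(** A 1 at the top left gives [z1] the exponent 0 and [z4] the largest one. The new row pushes the 1
    of the right column down by one, whence the extra [z2]; the bottom exponent is counted from the
    right and does not change. *)
Lemma quad_add_corner z1 z2 z3 z4 (X : 'M[bool]_n.+1) : valid X ->
  quad z1 z2 z3 z4 (add_corner X) = z4 ^+ n.+1 * z2 * quad 1 z2 z3 1 X.
Proof.
move=> vX; have [p Xp] := right_unique vX.
have vA : valid (add_corner X) by rewrite valid_add_corner.
have E1 : expT (add_corner X) = 0%N.
  by rewrite /expT big1 // => j _; case: (unliftP ord0 j) => [k|] ->;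
    rewrite add_cornerE ?muln0.
have E2 : expR (add_corner X) = (expR X).+1.
  rewrite /expR big_ord_recl mul0n add0n ord_maxS (sum_pred1 _ Xp).
  rewrite (eq_bigr (fun i : 'I_n.+1 => i.+1 * X i ord_max)%N) => [|i _].
    by rewrite (sum_pred1 _ Xp).
  by rewrite add_cornerE.
have E3 : expB (add_corner X) = expB X.
  rewrite /expB big_ord_recl ord_maxS add_cornerE muln0 add0n.
  by apply: eq_bigr => j _; rewrite add_cornerE.
have E4 : expL (add_corner X) = n.+1.
  rewrite /expL big_ord_recl add_cornerE muln1 /= subn1 big1 ?addn0 // => i _.
  by rewrite add_cornerE muln0.
rewrite /quad E1 E2 E3 E4 !expr1n exprS; move: (expR X) (expB X) => k l; ring.
Qed.

(** Refinement along two adjacent sides, right and bottom; [Adj_Zopp] will trade it for opposite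
    sides. *)
Definition Adj z2 z3 : R := \sum_(X : 'M[bool]_n.+1 | valid X) quad 1 z2 z3 1 X.

Definition nvalid : R := \sum_(X : 'M[bool]_n | valid X) 1.

Lemma Qsum00 z1 z2 z3 z4 :
  Qsum n.+1 false false z1 z2 z3 z4 = z4 ^+ n.+1 * z2 * Adj z2 z3.
Proof.
rewrite /Qsum /Adj mulr_sumr.
rewrite -(eq_bigr _ (fun X vX => quad_add_corner z1 z2 z3 z4 vX)).
rewrite -(sum_corner (fun X => quad z1 z2 z3 z4 X)) [RHS]big_mkcondr.
by apply: eq_bigr => X _ /=; case: (X _ _); rewrite ?mulr1 ?mulr0.
Qed.

End CornerSums.

Section CornerExpansion.
Variables (R : comNzRingType) (m : nat).
Implicit Types z : R.

Lemma Adj11 n : Adj n 1 1 = nvalid R n.+1.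
Proof. by apply: eq_bigr => X _; rewrite /quad !expr1n !mulr1. Qed.

Lemma Qsum_max_max z2 z3 :
  Qsum m.+1 true true 1 z2 z3 1 = z2 ^+ m.+1 * nvalid R m.+1.
Proof. by rewrite 2!Qsum_rotm Qsum00 Adj11 mulr1. Qed.

Definition Qdiag z1 z2 z3 z4 : R :=
  \sum_(X : 'M[bool]_m.+3 | valid X) quad z1 z2 z3 z4 X
    * ((X ord0 ord0)%:R * (X ord_max ord_max)%:R).

Definition Qanti z1 z2 z3 z4 : R :=
  \sum_(X : 'M[bool]_m.+3 | valid X) quad z1 z2 z3 z4 X
    * ((X ord0 ord_max)%:R * (X ord_max ord0)%:R).

Lemma QdiagE z1 z2 z3 z4 :
  Qdiag z1 z2 z3 z4 = z4 ^+ m.+2 * z2 ^+ m.+2 * nvalid R m.+1.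
Proof.
transitivity (z4 ^+ m.+2 * z2 * Qsum m.+1 true true 1 z2 z3 1); last first.
  by rewrite Qsum_max_max [z2 ^+ m.+2]exprS; ring.
transitivity (\sum_(X : 'M[bool]_m.+2 | valid X)
    quad z1 z2 z3 z4 (add_corner X) * (add_corner X ord_max ord_max)%:R).
  rewrite -(sum_corner (fun X => quad z1 z2 z3 z4 X * (X ord_max ord_max)%:R)).
  rewrite [RHS]big_mkcondr; apply: eq_bigr => X _ /=.
  by case: (X ord0 ord0); rewrite ?mul1r ?mul0r ?mulr0.
rewrite /Qsum mulr_sumr; apply: eq_bigr => X vX.
by rewrite quad_add_corner // mulrA ord_maxS add_cornerE.
Qed.

Lemma QantiE z1 z2 z3 z4 :
  Qanti z1 z2 z3 z4 = z1 ^+ m.+2 * z3 ^+ m.+2 * nvalid R m.+1.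
Proof.
rewrite -(QdiagE z2 z3 z4 z1) /Qanti sum_rotm; apply: eq_bigr => X _.
by rewrite quad_rotm !mxE rev_ord0 rev_ord_max.
Qed.

(** Each factor of [corners] is [d] plus [1 - d] times the indicator of a 1. Two corners on a common
    side cannot both carry a 1, so only seven of the sixteen products survive: no corner, a single
    one, or a diagonal pair. *)
Lemma sum_corners d1 d2 d3 d4 z1 z2 z3 z4 :
  \sum_(X : 'M[bool]_m.+3 | valid X)
    quad z1 z2 z3 z4 X * corners d1 d2 d3 d4 X
  = d1 * d2 * d3 * d4 * Zquad_alt m.+3 z1 z2 z3 z4
    + (1 - d1) * d2 * d3 * d4 * (z4 ^+ m.+2 * z2 * Adj m.+1 z2 z3)
    + (1 - d2) * d1 * d3 * d4 * (z1 ^+ m.+2 * z3 * Adj m.+1 z3 z4)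
    + (1 - d3) * d1 * d2 * d4 * (z2 ^+ m.+2 * z4 * Adj m.+1 z4 z1)
    + (1 - d4) * d1 * d2 * d3 * (z3 ^+ m.+2 * z1 * Adj m.+1 z1 z2)
    + (1 - d1) * (1 - d3) * d2 * d4 * (z4 ^+ m.+2 * z2 ^+ m.+2 * nvalid R m.+1)
    + (1 - d2) * (1 - d4) * d1 * d3 * (z1 ^+ m.+2 * z3 ^+ m.+2 * nvalid R m.+1).
Proof.
rewrite -(QdiagE z1 z2 z3 z4) -(QantiE z1 z2 z3 z4).
have Q1 := Qsum00 m.+1 z1 z2 z3 z4.
have Q2 : Qsum m.+2 false true z1 z2 z3 z4 = z1 ^+ m.+2 * z3 * Adj m.+1 z3 z4.
  by rewrite Qsum_rotm Qsum00.
have Q3 : Qsum m.+2 true true z1 z2 z3 z4 = z2 ^+ m.+2 * z4 * Adj m.+1 z4 z1.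
  by rewrite 2!Qsum_rotm Qsum00.
have Q4 : Qsum m.+2 true false z1 z2 z3 z4 = z3 ^+ m.+2 * z1 * Adj m.+1 z1 z2.
  by rewrite 3!Qsum_rotm Qsum00.
rewrite -Q1 -Q2 -Q3 -Q4 Zquad_altE /Qsum /Qdiag /Qanti !mulr_sumr -!big_split.
apply: eq_bigr => X vX /=; rewrite /corners.
have [p1 X1] := top_unique vX; have [p2 X2] := right_unique vX.
have [p3 X3] := bottom_unique vX; have [p4 X4] := left_unique vX.
have m0 : (ord_max == ord0 :> 'I_m.+3) = false by [].
have : ~~ (X ord0 ord0 && X ord0 ord_max).
  by rewrite !X1 /=; case: eqP => // <-; rewrite m0.
have : ~~ (X ord_max ord0 && X ord_max ord_max).
  by rewrite !X3 /=; case: eqP => // <-; rewrite m0.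
have : ~~ (X ord0 ord0 && X ord_max ord0).
  by rewrite !X4 /=; case: eqP => // <-; rewrite m0.
have : ~~ (X ord0 ord_max && X ord_max ord_max).
  by rewrite !X2 /=; case: eqP => // <-; rewrite m0.
case: (X ord0 ord0); case: (X ord0 ord_max); case: (X ord_max ord_max);
  by case: (X ord_max ord0) => //= _ _ _ _; ring.
Qed.

(** When [z1] and [z4] are 1, the only nontrivial correction is at the corner where the right and
    bottom sides meet. *)
Lemma sum_corners_adj d3 z2 z3 :
  \sum_(X : 'M[bool]_m.+2 | valid X) quad 1 z2 z3 1 X * corners 1 1 d3 1 X
  = d3 * Adj m.+1 z2 z3 + (1 - d3) * (z2 ^+ m.+1 * nvalid R m.+1).
Proof.
rewrite -(Qsum_max_max z2 z3) /Adj /Qsum !mulr_sumr -big_split.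
apply: eq_bigr => X _; rewrite /corners /= !if_same.
by case: (X ord_max ord_max) => /=; ring.
Qed.

End CornerExpansion.

(** * Back to the boundary refinements *)

Lemma nvalidE (R : comNzRingType) n : nvalid R n = (asm_number n)%:R.
Proof. by rewrite asm_numberE -sumr_const; apply: eq_bigl => X; rewrite inE. Qed.

Lemma asm_number_gt0 n : (0 < asm_number n)%N.
Proof.
suff [X vX] : exists X : 'M[bool]_n, valid X.
  by rewrite asm_numberE; apply/card_gt0P; exists X; rewrite inE.
elim: n => [|n [X vX]]; last by exists (add_corner X); rewrite valid_add_corner.
by exists (const_mx true); apply/validP; split; case.
Qed.

Lemma Zopp_sym (R : comNzRingType) n (x y : R) : Zopp n.+1 x y = Zopp n.+1 y x.
Proof.
rewrite !ZoppE sum_rotm sum_rotm; apply: eq_bigr => X _.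
by rewrite !quad_rotm.
Qed.

Section Counting.
Variables (T : eqType) (P : pred T).

Lemma count_vcons n (x : T) (u : 'I_n -> T) :
  (\sum_i P (vcons x u i) = P x + \sum_i P (u i))%N.
Proof.
rewrite big_ord_recl vcons0; congr (_ + _)%N.
by apply: eq_bigr => i _; rewrite vconsl.
Qed.

Lemma count_vcat m n (u : 'I_m -> T) (v : 'I_n -> T) :
  (\sum_i P (vcat u v i) = \sum_i P (u i) + \sum_i P (v i))%N.
Proof.
by rewrite big_split_ord; congr (_ + _)%N; apply: eq_bigr => i _;
  rewrite ?vcatl ?vcatr.
Qed.

End Counting.

Lemma count_bd (R : comNzRingType) (P : pred R) n (a c : R) :
  (\sum_(i < n.+2) P (bd a c i) = P a + n * P 1%R + P c)%N.
Proof.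
rewrite big_ord_recl big_ord_recr /= addnA -ord_maxS.
congr (_ + _ + _)%N; last by rewrite /bd eqxx.
have -> : (n * P 1%R = \sum_(i < n) P 1%R)%N by rewrite sum_nat_const card_ord.
apply: eq_bigr => i _.
rewrite /bd /=; case: eqP => // /(congr1 val) /=.
by rewrite /bump /= add1n => -[] /eqP; rewrite ltn_eqF.
Qed.

(** By [spectral_ab], the weight of a zero at the crossing of two special lines divided by the
    factors [bweight] of these lines. *)
Definition zfac (R : pzRingType) (x y : R) : R := x * y - x + 1.

Section Final.
Variables (K : fieldType) (q : K).
Hypotheses (hq : q ^+ 2 = q - 1) (hchar : [pchar K] =i pred0).
Local Notation al := (alpha q).
Local Notation be := (beta q).
Let h3 : 3 != 0 :> K := char3 hchar.

(** Counting every predicate expresses equality of the two multisets of parameters, which avoids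
    writing down permutations. *)
Lemma Z6v_count n (u v u' v' : 'I_n -> K) :
  (forall P : pred K, \sum_i P (u' i) + \sum_i P (v' i)
                      = \sum_i P (u i) + \sum_i P (v i))%N ->
  Z6v al be u' v' * \prod_j v j = Z6v al be u v * \prod_j v' j.
Proof.
move=> uv.
have cE n' (w : 'I_n' -> K) (P : pred K) :
    count P [tuple w i | i < n'] = (\sum_i P (w i))%N.
  rewrite count_map -sum1_count big_mkcond big_enum /=.
  by apply: eq_bigr => i _; case: (P (w i)).
have /tuple_permP[s sE] : perm_eq [tuple vcat u' v' i | i < n + n]
                                 [tuple vcat u v i | i < n + n].
  by apply/seq.permP => P; rewrite !cE !count_vcat.
apply: (Z6v_sym hq hchar (s := s)) => i.
have := congr1 (fun t => nth 0 t i) sE.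
by rewrite -!tnth_nth !tnth_mktuple.
Qed.

Lemma alpha_add_beta : al + be = 1.
Proof. by rewrite /alpha /beta; field. Qed.

Lemma Z6v_ones n : Z6v al be (@ones K n) (@ones K n) = (asm_number n)%:R.
Proof.
rewrite -nvalidE; apply: eq_bigr => X /validP[_ _ e].
rewrite big1 // => i _; rewrite big1 // => j _; rewrite /vw /ones !mulr1.
case x: (X i j); first by rewrite e // eqxx; case: ifP.
by case: ifP => _; rewrite ?alpha_add_beta // addrC alpha_add_beta.
Qed.

Lemma asm_number_neq0 n : (asm_number n)%:R != 0 :> K.
Proof. by rewrite (pcharf0P K).1 // -lt0n asm_number_gt0. Qed.

(* The spectral parameter at which the ratio of the two weights of a zero, in
   a line whose crossing lines have spectral parameter 1, is z. *)
Definition spectral (z : K) : K := (al * z - be) / (al - be * z).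
Definition bweight (z : K) : K := (al - be) / (al - be * z).

Definition admissible (z : K) : Prop :=
  [/\ z != 0, al - be * z != 0 & al * z - be != 0].

(** The discriminant 1 - 4/3 of the quadratic polynomial with roots [al] and [be]. *)
Lemma alpha_sub_beta_sqr : (al - be) ^+ 2 = - 3^-1.
Proof. by rewrite /alpha /beta; field: hq. Qed.

Lemma alpha_sub_beta_neq0 : al - be != 0.
Proof.
rewrite -sqrf_eq0 alpha_sub_beta_sqr oppr_eq0 invr_eq0; exact: h3.
Qed.

Lemma spectral_neq0 z : admissible z -> spectral z != 0.
Proof. by case=> z0 d0 n0; rewrite mulf_neq0 ?invr_eq0. Qed.

Lemma bweight_neq0 z : admissible z -> bweight z != 0.
Proof. by case=> z0 d0 n0; rewrite mulf_neq0 ?invr_eq0 ?alpha_sub_beta_neq0. Qed.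

Lemma spectral_b z : admissible z -> be * spectral z + al = bweight z.
Proof.
case=> z0 d0 n0; rewrite /spectral /bweight.
apply: (mulIf d0); rewrite mulrDl mulrA !divfK //.
by rewrite /alpha /beta; field: hq.
Qed.

Lemma spectral_a z : admissible z -> al * spectral z + be = bweight z * z.
Proof.
case=> z0 d0 n0; rewrite /spectral /bweight.
apply: (mulIf d0); rewrite mulrDl mulrA [RHS]mulrAC !divfK //.
by rewrite /alpha /beta; field: hq.
Qed.

Lemma spectral_ab x y : admissible x -> admissible y ->
  al * spectral x + be * spectral y = zfac y x * bweight x * bweight y.
Proof.
move=> [x0 dx nx] [y0 dy ny]; rewrite /spectral /bweight /zfac.
have d0 : (al - be * x) * (al - be * y) != 0 by rewrite mulf_neq0.
apply: (mulIf d0).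
transitivity (al * (al * x - be) * (al - be * y)
  + be * (al * y - be) * (al - be * x)).
  by move: (al) (be) dx dy => A B dx dy; field; rewrite dx dy.
transitivity ((y * x - y + 1) * (al - be) ^+ 2); last first.
  by move: (al) (be) dx dy => A B dx dy; field; rewrite dx dy.
by rewrite alpha_sub_beta_sqr /alpha /beta; field: hq.
Qed.

(** The corner quotient [d] of [Z6v_bd]: of the two line weights of a corner zero, one carries the
    factor [y]. *)
Definition corner_ratio (x y : K) : K := zfac x y / y.

Lemma spectral_corner_ratio x y : admissible x -> admissible y ->
  al * spectral x + be * spectral y = corner_ratio y x * (bweight x * x) * bweight y.
Proof.
move=> ax ay; rewrite spectral_ab // /corner_ratio; case: ax => x0 _ _; by field.
Qed.

Lemma s3_spectral x y : admissible x -> admissible y ->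
  s3 (spectral x) (spectral y) = 3 * zfac x y * zfac y x * (bweight x * bweight y) ^+ 2.
Proof.
move=> ax ay; rewrite (s3_factor hq hchar) [be * _ + _]addrC !spectral_ab //; ring.
Qed.

Lemma sub_spectral x y : admissible x -> admissible y ->
  (spectral x - spectral y) * (al - be) = bweight x * bweight y * (x - y).
Proof.
move=> [x0 dx nx] [y0 dy ny]; rewrite /spectral /bweight.
transitivity ((al - be) ^+ 2 * (al + be) * (x - y)
  / ((al - be * x) * (al - be * y))).
  by move: (al) (be) dx dy => A B dx dy; field; rewrite dx dy.
rewrite alpha_add_beta mulr1.
by move: (al) (be) dx dy => A B dx dy; field; rewrite dx dy.
Qed.

Lemma Z6v_boundary m z1 z2 z3 z4 : admissible z1 -> admissible z2 -> admissible z3 -> admissible z4 ->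
  Z6v al be (bd (n := m) (spectral z1) (spectral z3)) (bd (spectral z4) (spectral z2))
  = spectral z4 * spectral z2 * (bweight z1 * bweight z2 * bweight z3 * bweight z4) ^+ m.+1
    * \sum_(X : 'M[bool]_m.+2 | valid X) quad z1 z2 z3 z4 X
        * corners (corner_ratio z4 z1) (corner_ratio z1 z2) (corner_ratio z2 z3) (corner_ratio z3 z4) X.
Proof.
move=> a1 a2 a3 a4.
apply: Z6v_bd; first exact: alpha_add_beta; rewrite ?spectral_b ?spectral_a ?spectral_corner_ratio //;
  by rewrite addrC ?spectral_b ?spectral_a ?spectral_corner_ratio.
Qed.

Lemma admissible1 : admissible 1.
Proof.
split; rewrite ?oner_neq0 //; rewrite ?mulr1 alpha_sub_beta_neq0 //.
Qed.

Lemma spectral1 : spectral 1 = 1.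
Proof. by rewrite /spectral !mulr1 divff ?alpha_sub_beta_neq0. Qed.

Lemma bweight1 : bweight 1 = 1.
Proof. by rewrite /bweight mulr1 divff ?alpha_sub_beta_neq0. Qed.

Lemma corner_ratio1x x : admissible x -> corner_ratio 1 x = 1.
Proof. by case=> x0 _ _; rewrite /corner_ratio /zfac mul1r subrK divff. Qed.

Lemma corner_ratiox1 x : corner_ratio x 1 = 1.
Proof. by rewrite /corner_ratio /zfac mulr1 subrr add0r divr1. Qed.

Lemma Z6v_opposite m x y : admissible x -> admissible y ->
  Z6v al be (bd (n := m) (spectral x) (spectral y)) (bd 1 1)
  = (bweight x * bweight y) ^+ m.+1 * Zopp m.+2 x y.
Proof.
move=> ax ay; rewrite -spectral1 Z6v_boundary //; try exact: admissible1.
rewrite spectral1 bweight1 !(mul1r, mulr1) ZoppE; congr (_ * _).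
apply: eq_bigr => X _; rewrite !corner_ratiox1 !corner_ratio1x // /corners !if_same.
by rewrite !mulr1.
Qed.

Lemma prod_bd m (b d : K) : \prod_i bd (n := m) b d i = b * d.
Proof.
rewrite big_ord_recl big_ord_recr /= -ord_maxS.
rewrite big1 ?mul1r => [|i _]; first by rewrite /bd !eqxx.
rewrite /bd /=; case: eqP => // /(congr1 val) /=.
by rewrite /bump /= add1n => -[] /eqP; rewrite ltn_eqF.
Qed.

(** Placing [spectral x] and [spectral y] on the right and bottom lines, or on the top and bottom
    lines, gives the same multiset of parameters, hence the same partition function up to
    [spectral x]. Only the first placement has a corner where the two special lines cross. *)
Lemma Adj_Zopp m x y : admissible x -> admissible y ->
  corner_ratio x y * Adj m.+1 x y + (1 - corner_ratio x y) * (x ^+ m.+1 * (asm_number m.+1)%:R)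
  = Zopp m.+2 x y.
Proof.
move=> ax ay; rewrite -nvalidE -sum_corners_adj.
have a1 := admissible1; have sx := spectral_neq0 ax.
have E := Z6v_boundary m a1 ax ay a1; rewrite spectral1 bweight1 !(mulr1, mul1r) in E.
rewrite corner_ratiox1 corner_ratio1x // in E; rewrite corner_ratiox1 in E.
have C := @Z6v_count _ (bd (n := m) (spectral x) (spectral y)) (bd 1 1)
  (bd 1 (spectral y)) (bd 1 (spectral x)).
rewrite !prod_bd Z6v_opposite // E !mul1r mulr1 in C.
have B0 : (bweight x * bweight y) ^+ m.+1 != 0.
  by apply: expf_neq0; apply: mulf_neq0; apply: bweight_neq0.
apply: (mulfI B0); apply: (mulfI sx); rewrite [RHS]mulrC mulrA C //.
by move=> P; rewrite !count_bd; lia.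
Qed.

Lemma prod_vcons_ones n (x : K) : \prod_i vcons x (@ones K n) i = x.
Proof.
rewrite big_ord_recl vcons0 big1 ?mulr1 // => i _.
by rewrite vconsl.
Qed.

Lemma Z6v_pair m x y : admissible x -> admissible y ->
  Z6v al be (vcons (spectral x) (@ones K m.+1)) (vcons (spectral y) (@ones K m.+1))
  = spectral y * (bweight x * bweight y) ^+ m.+1 * Zopp m.+2 y x.
Proof.
move=> ax ay; rewrite Zopp_sym.
have C := @Z6v_count _ (bd (n := m) (spectral x) (spectral y)) (bd 1 1)
  (vcons (spectral x) (@ones K m.+1)) (vcons (spectral y) (@ones K m.+1)).
rewrite prod_bd prod_vcons_ones !mulr1 Z6v_opposite // in C.
rewrite C 1?mulrC ?mulrA // => P.
by rewrite !count_vcons !count_bd /ones !sum_nat_const !card_ord !mulSn; ring.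
Qed.

(** Condensation puts the special parameters on the first two rows and columns, the refinement on
    the extreme ones. *)
Lemma Z6v_two_pairs m a b c d : b != 0 -> d != 0 ->
  Z6v al be (vcons a (vcons c (@ones K m.+1))) (vcons b (vcons d (@ones K m.+1)))
  = Z6v al be (bd (n := m.+1) a c) (bd b d).
Proof.
move=> b0 d0.
have C := @Z6v_count _ (bd (n := m.+1) a c) (bd b d)
  (vcons a (vcons c (@ones K m.+1))) (vcons b (vcons d (@ones K m.+1))).
rewrite prod_bd big_ord_recl vcons0 in C.
apply: (mulIf (mulf_neq0 b0 d0)); rewrite C => [|P].
  congr (_ * (_ * _)); rewrite -[RHS](prod_vcons_ones m.+1).
  by apply: eq_bigr => i _; rewrite vconsl.
by rewrite !count_vcons !count_bd /ones !sum_nat_const !card_ord !mulSn; ring.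
Qed.

End Final.

(** * The identity over a field with a primitive sixth root of unity *)

Section Main.
Variables (K : fieldType) (q : K).
Hypotheses (hq : q ^+ 2 = q - 1) (hchar : [pchar K] =i pred0).
Variables (m : nat) (z1 z2 z3 z4 : K).
Hypotheses (a1 : admissible q z1) (a2 : admissible q z2) (a3 : admissible q z3) (a4 : admissible q z4).
Local Notation A := ((asm_number m.+1)%:R : K).
Local Notation O := (@Zopp K m.+2).
Local Notation e := (alpha q - beta q).

(** Condensation at the spectral parameters of the z's. The two factors 3 hidden in the [s3] are
    balanced by the 3 of condensation and by the square of [al - be], equal to [- 3^-1], whose sign
    turns [z3 - z1] into [z1 - z3]. *)
Lemma condensed T :
  T = \sum_(X : 'M[bool]_m.+3 | valid X) quad z1 z2 z3 z4 X
        * corners (corner_ratio z4 z1) (corner_ratio z1 z2) (corner_ratio z2 z3) (corner_ratio z3 z4) X ->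
  T * A * ((z1 - z3) * (z2 - z4))
  = zfac z1 z2 * zfac z2 z1 * zfac z3 z4 * zfac z4 z3 * O z4 z1 * O z2 z3
    - zfac z4 z1 * zfac z1 z4 * zfac z2 z3 * zfac z3 z2 * O z1 z2 * O z3 z4.
Proof.
move=> TE; have Z0 : Z6v (alpha q) (beta q) (@ones K m.+1) (@ones K m.+1) != 0.
  by rewrite Z6v_ones // asm_number_neq0.
have := condensation1 hq hchar (spectral q z1) (spectral q z4) (spectral q z3) (spectral q z2) Z0.
rewrite Z6v_two_pairs ?spectral_neq0 // Z6v_boundary // -TE Z6v_ones //.
rewrite !Z6v_pair // (Zopp_sym _ z2 z1) (Zopp_sym _ z4 z3) !s3_spectral //.
have h3 := char3 hchar; have e0 := alpha_sub_beta_neq0 hq hchar.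
have ca := sub_spectral hchar a3 a1; have db := sub_spectral hchar a2 a4.
have e2 := alpha_sub_beta_sqr hq hchar.
have := spectral_neq0 a2; have := spectral_neq0 a4.
have := bweight_neq0 hq hchar a1; have := bweight_neq0 hq hchar a2.
have := bweight_neq0 hq hchar a3; have := bweight_neq0 hq hchar a4.
move: (O z4 z1) (O z2 z3) (O z1 z2) (O z3 z4) => o41 o23 o12 o34.
move: A (spectral q z1) (spectral q z2) (spectral q z3) (spectral q z4) ca db => N s1 s2 s3 s4.
move: (bweight q z1) (bweight q z2) (bweight q z3) (bweight q z4) => b1 b2 b3 b4.
move: (zfac z1 z2) (zfac z2 z1) (zfac z3 z4) (zfac z4 z3) (zfac z4 z1) (zfac z1 z4) (zfac z2 z3)
  (zfac z3 z2) => g12 g21 g34 g43 g41 g14 g23 g32.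
move: e e0 e2 => x x0 x2 ca db b40 b30 b20 b10 s40 s20 E.
have B0 : b1 * b2 * b3 * b4 != 0 by do ?apply: mulf_neq0.
have D0 : 3 * s4 * s2 * (b1 * b2 * b3 * b4) ^+ m.+3 != 0.
  by apply: mulf_neq0; [do ?apply: mulf_neq0|apply: expf_neq0].
apply: (mulfI D0).
transitivity (- (3 * (s4 * s2 * (b1 * b2 * b3 * b4) ^+ m.+2 * T) * N
  * (((s3 - s1) * x) * ((s2 - s4) * x)))); first by rewrite ca db exprS; ring.
transitivity (- (3 * (s4 * s2 * (b1 * b2 * b3 * b4) ^+ m.+2 * T) * N
  * ((s3 - s1) * (s2 - s4))) * x ^+ 2); first by ring.
rewrite E x2 -[m.+3]/(2 + m.+1)%N exprD !exprMn.
move: (b1 ^+ m.+1) (b2 ^+ m.+1) (b3 ^+ m.+1) (b4 ^+ m.+1) => p1 p2 p3 p4.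
by field.
Qed.

(** In [sum_corners] each [Adj] is multiplied by the ratio of its own corner, precisely the product
    that [Adj_Zopp] rewrites with [Zopp]. The products of the form [(x - 1) * (y - 1)] come from [1
    - corner_ratio x y = - (x - 1) * (y - 1) / y]. Each diagonal term occurs once in [sum_corners]
    and is subtracted twice by these substitutions. *)
Theorem main_identity : z1 != z3 -> z2 != z4 ->
  zfac z4 z1 * zfac z1 z2 * zfac z2 z3 * zfac z3 z4 * Zquad_alt m.+3 z1 z2 z3 z4
  = z1 * z2 * z3 * z4 / (A * (z1 - z3) * (z2 - z4))
    * (zfac z1 z2 * zfac z2 z1 * zfac z3 z4 * zfac z4 z3 * O z4 z1 * O z2 z3
       - zfac z4 z1 * zfac z1 z4 * zfac z2 z3 * zfac z3 z2 * O z1 z2 * O z3 z4)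
  + (z2 - 1) * (z3 - 1) * zfac z1 z2 * zfac z3 z4 * (z4 * z1 * z2 ^+ m.+2) * O z4 z1
  + (z3 - 1) * (z4 - 1) * zfac z2 z3 * zfac z4 z1 * (z1 * z2 * z3 ^+ m.+2) * O z1 z2
  + (z4 - 1) * (z1 - 1) * zfac z3 z4 * zfac z1 z2 * (z2 * z3 * z4 ^+ m.+2) * O z2 z3
  + (z1 - 1) * (z2 - 1) * zfac z4 z1 * zfac z2 z3 * (z3 * z4 * z1 ^+ m.+2) * O z3 z4
  + (z1 - 1) * (z2 - 1) * (z3 - 1) * (z4 - 1)
      * (zfac z1 z2 * zfac z3 z4 * (z2 * z4) ^+ m.+2
         + zfac z2 z3 * zfac z4 z1 * (z1 * z3) ^+ m.+2) * A.
Proof.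
move=> z13 z24; have := condensed (erefl _).
rewrite sum_corners nvalidE.
have E41 := Adj_Zopp hq hchar m a4 a1; have E23 := Adj_Zopp hq hchar m a2 a3.
have E12 := Adj_Zopp hq hchar m a1 a2; have E34 := Adj_Zopp hq hchar m a3 a4.
have N0 := asm_number_neq0 hchar m.+1.
have [z10 _ _] := a1; have [z20 _ _] := a2.
have [z30 _ _] := a3; have [z40 _ _] := a4.
have z13' : z1 - z3 != 0 by rewrite subr_eq0.
have z24' : z2 - z4 != 0 by rewrite subr_eq0.
rewrite !exprMn ![_ ^+ m.+2]exprS.
move: (z1 ^+ m.+1) (z2 ^+ m.+1) (z3 ^+ m.+1) (z4 ^+ m.+1) E41 E23 E12 E34
  => w1 w2 w3 w4.
move: (O z4 z1) (O z2 z3) (O z1 z2) (O z3 z4) (Adj _ z4 z1) (Adj _ z2 z3)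
  (Adj _ z1 z2) (Adj _ z3 z4) (Zquad_alt _ _ _ _ _) => o41 o23 o12 o34.
move: A N0 => N N0 x41 x23 x12 x34 Q E41 E23 E12 E34.
set D := (X in _ = X -> _) => TE.
have -> : z1 * z2 * z3 * z4 / (N * (z1 - z3) * (z2 - z4)) * D
  = z1 * z2 * z3 * z4 * (corner_ratio z4 z1 * corner_ratio z1 z2 * corner_ratio z2 z3 * corner_ratio z3 z4 * Q
    + (1 - corner_ratio z4 z1) * corner_ratio z1 z2 * corner_ratio z3 z4 * (z4 * w4 * z2 * (corner_ratio z2 z3 * x23))
    + (1 - corner_ratio z1 z2) * corner_ratio z4 z1 * corner_ratio z2 z3 * (z1 * w1 * z3 * (corner_ratio z3 z4 * x34))
    + (1 - corner_ratio z2 z3) * corner_ratio z1 z2 * corner_ratio z3 z4 * (z2 * w2 * z4 * (corner_ratio z4 z1 * x41))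
    + (1 - corner_ratio z3 z4) * corner_ratio z4 z1 * corner_ratio z2 z3 * (z3 * w3 * z1 * (corner_ratio z1 z2 * x12))
    + (1 - corner_ratio z4 z1) * (1 - corner_ratio z2 z3) * corner_ratio z1 z2 * corner_ratio z3 z4 * (z4 * w4 * (z2 * w2) * N)
    + (1 - corner_ratio z1 z2) * (1 - corner_ratio z3 z4) * corner_ratio z4 z1 * corner_ratio z2 z3 * (z1 * w1 * (z3 * w3) * N)).
  by rewrite -TE; field; rewrite N0 z13' z24'.
have -> : corner_ratio z2 z3 * x23 = o23 - (1 - corner_ratio z2 z3) * (w2 * N) by rewrite -E23; ring.
have -> : corner_ratio z3 z4 * x34 = o34 - (1 - corner_ratio z3 z4) * (w3 * N) by rewrite -E34; ring.
have -> : corner_ratio z4 z1 * x41 = o41 - (1 - corner_ratio z4 z1) * (w4 * N) by rewrite -E41; ring.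
have -> : corner_ratio z1 z2 * x12 = o12 - (1 - corner_ratio z1 z2) * (w1 * N) by rewrite -E12; ring.
by rewrite /corner_ratio /zfac; field; rewrite z10 z20 z30 z40.
Qed.

End Main.

(** * Descent to indeterminates over the integers *)

(* The difference of the two sides of the identity, without denominators. *)
Definition cleared (R : pzRingType) (N z1 z2 z3 z4 w1 w2 w3 w4 Q o41 o23 o12 o34 : R) : R :=
  N * (z1 - z3) * (z2 - z4) * (zfac z4 z1 * zfac z1 z2 * zfac z2 z3 * zfac z3 z4 * Q)
  - (z1 * z2 * z3 * z4
    * (zfac z1 z2 * zfac z2 z1 * zfac z3 z4 * zfac z4 z3 * o41 * o23
       - zfac z4 z1 * zfac z1 z4 * zfac z2 z3 * zfac z3 z2 * o12 * o34)
  + N * (z1 - z3) * (z2 - z4) * (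
    (z2 - 1) * (z3 - 1) * zfac z1 z2 * zfac z3 z4 * (z4 * z1 * w2) * o41
  + (z3 - 1) * (z4 - 1) * zfac z2 z3 * zfac z4 z1 * (z1 * z2 * w3) * o12
  + (z4 - 1) * (z1 - 1) * zfac z3 z4 * zfac z1 z2 * (z2 * z3 * w4) * o23
  + (z1 - 1) * (z2 - 1) * zfac z4 z1 * zfac z2 z3 * (z3 * z4 * w1) * o34
  + (z1 - 1) * (z2 - 1) * (z3 - 1) * (z4 - 1)
      * (zfac z1 z2 * zfac z3 z4 * (w2 * w4) + zfac z2 z3 * zfac z4 z1 * (w1 * w3)) * N)).

Lemma rmorph_cleared (R S : pzRingType) (f : {rmorphism R -> S})
    N z1 z2 z3 z4 w1 w2 w3 w4 Q o41 o23 o12 o34 :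
  f (cleared N z1 z2 z3 z4 w1 w2 w3 w4 Q o41 o23 o12 o34)
  = cleared (f N) (f z1) (f z2) (f z3) (f z4) (f w1) (f w2) (f w3) (f w4)
      (f Q) (f o41) (f o23) (f o12) (f o34).
Proof. by rewrite /cleared /zfac !(rmorphB, rmorphD, rmorphM, rmorph1). Qed.

Definition defect (R : comNzRingType) m (z1 z2 z3 z4 : R) : R :=
  cleared (asm_number m.+1)%:R z1 z2 z3 z4
    (z1 ^+ m.+2) (z2 ^+ m.+2) (z3 ^+ m.+2) (z4 ^+ m.+2)
    (Zquad_alt m.+3 z1 z2 z3 z4) (Zopp m.+2 z4 z1) (Zopp m.+2 z2 z3)
    (Zopp m.+2 z1 z2) (Zopp m.+2 z3 z4).

Section Morphism.
Variables (R S : comNzRingType) (f : {rmorphism R -> S}).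

Lemma rmorph_Zquad n z1 z2 z3 z4 :
  f (Zquad_alt n z1 z2 z3 z4) = Zquad_alt n (f z1) (f z2) (f z3) (f z4).
Proof. by rewrite rmorph_sum; apply: eq_bigr => X _; rewrite !rmorphM !rmorphXn. Qed.

Lemma rmorph_Zopp n z1 z2 : f (Zopp n z1 z2) = Zopp n (f z1) (f z2).
Proof. by rewrite rmorph_sum; apply: eq_bigr => X _; rewrite !rmorphM !rmorphXn. Qed.

Lemma rmorph_defect m z1 z2 z3 z4 :
  f (defect m z1 z2 z3 z4) = defect m (f z1) (f z2) (f z3) (f z4).
Proof.
by rewrite rmorph_cleared !rmorphXn rmorph_nat rmorph_Zquad !rmorph_Zopp.
Qed.

End Morphism.

Lemma defect_eq0 (K : fieldType) m (z1 z2 z3 z4 : K) :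
  (asm_number m.+1)%:R != 0 :> K -> z1 != z3 -> z2 != z4 ->
  defect m z1 z2 z3 z4 = 0 <->
  zfac z4 z1 * zfac z1 z2 * zfac z2 z3 * zfac z3 z4 * Zquad_alt m.+3 z1 z2 z3 z4
  = z1 * z2 * z3 * z4 / ((asm_number m.+1)%:R * (z1 - z3) * (z2 - z4))
    * (zfac z1 z2 * zfac z2 z1 * zfac z3 z4 * zfac z4 z3 * Zopp m.+2 z4 z1 * Zopp m.+2 z2 z3
       - zfac z4 z1 * zfac z1 z4 * zfac z2 z3 * zfac z3 z2 * Zopp m.+2 z1 z2 * Zopp m.+2 z3 z4)
  + (z2 - 1) * (z3 - 1) * zfac z1 z2 * zfac z3 z4 * (z4 * z1 * z2 ^+ m.+2) * Zopp m.+2 z4 z1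
  + (z3 - 1) * (z4 - 1) * zfac z2 z3 * zfac z4 z1 * (z1 * z2 * z3 ^+ m.+2) * Zopp m.+2 z1 z2
  + (z4 - 1) * (z1 - 1) * zfac z3 z4 * zfac z1 z2 * (z2 * z3 * z4 ^+ m.+2) * Zopp m.+2 z2 z3
  + (z1 - 1) * (z2 - 1) * zfac z4 z1 * zfac z2 z3 * (z3 * z4 * z1 ^+ m.+2) * Zopp m.+2 z3 z4
  + (z1 - 1) * (z2 - 1) * (z3 - 1) * (z4 - 1)
      * (zfac z1 z2 * zfac z3 z4 * (z2 * z4) ^+ m.+2
         + zfac z2 z3 * zfac z4 z1 * (z1 * z3) ^+ m.+2) * (asm_number m.+1)%:R.
Proof.
rewrite -(subr_eq0 z1) -(subr_eq0 z2) => N0 z13 z24.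
rewrite /defect !exprMn.
move: (Zquad_alt _ _ _ _ _) (Zopp _ z4 z1) (Zopp _ z2 z3) (Zopp _ z1 z2)
  (Zopp _ z3 z4) => Q o41 o23 o12 o34.
move: (z1 ^+ m.+2) (z2 ^+ m.+2) (z3 ^+ m.+2) (z4 ^+ m.+2) => w1 w2 w3 w4.
move: (asm_number m.+1)%:R N0 => N N0.
set L := (X in _ <-> X = _); set D := (X in _ / _ * X).
set E := (X in _ <-> _ = X).
have D0 : N * (z1 - z3) * (z2 - z4) != 0 by do 2?apply: mulf_neq0.
have -> : cleared N z1 z2 z3 z4 w1 w2 w3 w4 Q o41 o23 o12 o34
    = N * (z1 - z3) * (z2 - z4) * (L - E).
  by rewrite /cleared -/D -/L /E; field; rewrite N0 z13 z24.
split=> [/eqP|->]; last by rewrite subrr mulr0.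
by rewrite mulf_eq0 (negbTE D0) subr_eq0 => /eqP.
Qed.

Lemma tofrac_neq0 (R : idomainType) (p : {mpoly R[4]}) v :
  p.@[v] != 0 -> @tofrac {mpoly R[4]} p != 0.
Proof. by rewrite tofrac_eq0; apply: contra_neq => ->; rewrite meval0. Qed.

Lemma map_mpoly_inj (R S : nzRingType) n (f : {rmorphism R -> S}) :
  injective f -> injective (map_mpoly (n := n) f).
Proof.
move=> f_inj p p' /mpolyP e; apply/mpolyP => k.
by apply: f_inj; rewrite -!mcoeff_map_mpoly e.
Qed.

(** A cube root of -1, that is, a primitive sixth root of unity, to serve as [q]. *)
Definition cube_root : algC := (1 + sqrtC (- 3)) / 2.

Lemma cube_rootE : cube_root ^+ 2 = cube_root - 1.
Proof.
have s : sqrtC (- 3) ^+ 2 = - 3 :> algC by rewrite sqrtCK.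
have n2 : 2 != 0 :> algC by rewrite pnatr_eq0.
by rewrite /cube_root; field: s.
Qed.

Theorem defect_indet m : defect m (indet 0) (indet 1) (indet 2) (indet 3) = 0.
Proof.
rewrite -(rmorph_defect (@tofrac {mpoly int[4]})).
apply/eqP; rewrite tofrac_eq0; apply/eqP.
pose f : {rmorphism int -> algC} := intr.
have f_inj : injective f by apply: intr_inj.
apply: (map_mpoly_inj f_inj).
rewrite (rmorph_defect (map_mpoly f)) rmorph0 /= !map_mpolyX.
pose K : fieldType := {fraction {mpoly algC[4]}}.
pose iota : {rmorphism algC -> K} := @tofrac {mpoly algC[4]} \o @mpolyC 4 algC.
apply/eqP; rewrite -tofrac_eq0 (rmorph_defect (@tofrac {mpoly algC[4]})) /=.
pose q : K := iota cube_root.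
have hq : q ^+ 2 = q - 1 by rewrite -rmorphXn cube_rootE rmorphB rmorph1.
have hchar : [pchar K] =i pred0.
  by move=> k; rewrite (fmorph_pchar iota) pchar_num.
have nz (p : {mpoly algC[4]}) v : p.@[v] != 0 -> @tofrac {mpoly algC[4]} p != 0.
  exact: tofrac_neq0.
have alE : alpha q = @tofrac {mpoly algC[4]} (alpha cube_root)%:MP.
  by rewrite /alpha -[RHS]/(iota _) fmorph_div rmorphD rmorph1 rmorph_nat.
have beE : beta q = @tofrac {mpoly algC[4]} (beta cube_root)%:MP.
  by rewrite /beta -[RHS]/(iota _) fmorph_div rmorphB !rmorph_nat.
have e0 : alpha cube_root - beta cube_root != 0.
  by apply: alpha_sub_beta_neq0 => //; [exact: cube_rootE | exact: pchar_num].
(* At the point with all coordinates 1 both linear conditions reduce to [al - be] being nonzero. *)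
have admX k : admissible q (@tofrac {mpoly algC[4]} 'X_k).
  split; rewrite ?alE ?beE -?tofracM -?tofracB;
    apply: (@tofrac_neq0 _ _ (fun=> 1));
    by rewrite ?mevalB ?mevalM ?mevalC ?mevalXU ?oner_neq0 ?mulr1.
have neqX k l : k != l -> @tofrac {mpoly algC[4]} 'X_k != @tofrac {mpoly algC[4]} 'X_l.
  move=> kl; rewrite -subr_eq0 -tofracB.
  apply: (@tofrac_neq0 _ _ (fun i => (i == k)%:R)).
  by rewrite mevalB !mevalXU eqxx [l == k]eq_sym (negbTE kl) subr0 oner_neq0.
have i4 (k l : nat) : (k < 4)%N -> (l < 4)%N -> k != l ->
    inord k != inord l :> 'I_4.
  by move=> k4 l4; apply: contra_neq => /(congr1 val); rewrite /= !inordK.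
apply/eqP/defect_eq0; rewrite ?neqX ?i4 //; first exact: asm_number_neq0.
apply: (main_identity hq hchar m (admX _) (admX _) (admX _) (admX _));
  by rewrite neqX ?i4.
Qed.

Theorem corollary10 (n : nat) (hn : (3 <= n)%N) :
  let z1 := indet 0 in
  let z2 := indet 1 in
  let z3 := indet 2 in
  let z4 := indet 3 in
  (z4 * z1 - z4 + 1) * (z1 * z2 - z1 + 1)
    * (z2 * z3 - z2 + 1) * (z3 * z4 - z3 + 1) * Zquad_alt n z1 z2 z3 z4
  = z1 * z2 * z3 * z4 / ((asm_number (n - 2))%:R * (z1 - z3) * (z2 - z4))
    * ((z1 * z2 - z1 + 1) * (z1 * z2 - z2 + 1)
         * (z3 * z4 - z3 + 1) * (z3 * z4 - z4 + 1)
         * Zopp (n - 1) z4 z1 * Zopp (n - 1) z2 z3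
       - (z4 * z1 - z4 + 1) * (z4 * z1 - z1 + 1)
         * (z2 * z3 - z2 + 1) * (z2 * z3 - z3 + 1)
         * Zopp (n - 1) z1 z2 * Zopp (n - 1) z3 z4)
  + (z2 - 1) * (z3 - 1) * (z1 * z2 - z1 + 1) * (z3 * z4 - z3 + 1)
      * (z4 * z1 * z2 ^+ (n - 1)) * Zopp (n - 1) z4 z1
  + (z3 - 1) * (z4 - 1) * (z2 * z3 - z2 + 1) * (z4 * z1 - z4 + 1)
      * (z1 * z2 * z3 ^+ (n - 1)) * Zopp (n - 1) z1 z2
  + (z4 - 1) * (z1 - 1) * (z3 * z4 - z3 + 1) * (z1 * z2 - z1 + 1)
      * (z2 * z3 * z4 ^+ (n - 1)) * Zopp (n - 1) z2 z3
  + (z1 - 1) * (z2 - 1) * (z4 * z1 - z4 + 1) * (z2 * z3 - z2 + 1)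
      * (z3 * z4 * z1 ^+ (n - 1)) * Zopp (n - 1) z3 z4
  + (z1 - 1) * (z2 - 1) * (z3 - 1) * (z4 - 1)
      * ((z1 * z2 - z1 + 1) * (z3 * z4 - z3 + 1) * (z2 * z4) ^+ (n - 1)
         + (z2 * z3 - z2 + 1) * (z4 * z1 - z4 + 1) * (z1 * z3) ^+ (n - 1))
      * (asm_number (n - 2))%:R.
Proof.
case: n hn => [|[|[|m]]] // _; rewrite !subSS !subn0.
have neqX (k l : nat) : (k < 4)%N -> (l < 4)%N -> k != l -> indet k != indet l.
  move=> k4 l4 kl; rewrite -subr_eq0 /indet -tofracB.
  apply: (@tofrac_neq0 _ _ (fun i => (i == inord k)%:R)).
  rewrite mevalB !mevalXU eqxx -val_eqE /= !inordK // [l == k]eq_sym.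
  by rewrite (negbTE kl) subr0 oner_neq0.
have N0 : (asm_number m.+1)%:R != 0 :> ratfun4.
  rewrite -(rmorph_nat (@tofrac {mpoly int[4]})).
  apply: (@tofrac_neq0 _ _ (fun=> 0)).
  by rewrite rmorph_nat pnatr_eq0 -lt0n asm_number_gt0.
move=> z1 z2 z3 z4.
have /defect_eq0 := defect_indet m; rewrite /zfac [z2 * z1]mulrC [z4 * z3]mulrC
  [z1 * z4]mulrC [z3 * z2]mulrC; apply; rewrite ?neqX //.
Qed.
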